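(* Let $p(n)$ denote the partition function. Then the sequence $p(n)^2-p(n-1)p(n+1)$ is increasing for $n\ge 55$, i.e. for every integer $n\ge 55$, $$p(n)^2-p(n-1)p(n+1)\le p(n+1)^2-p(n)p(n+2).$$
   Context: $p(n)$ is the number of integer partitions of $n$. ''Increasing'' is understood in the weak sense. *)

(* Defs.v *)
From mathcomp Require Import all_boot all_order all_algebra.

Set Implicit Arguments.
Unset Strict Implicit.
Unset Printing Implicit Defensive.

Definition is_partition (n : nat) (s : seq nat) : bool :=
  [&& sorted geq s, 0 \notin s & sumn s == n].

(* A partition of n has at most n parts, each at most n, so the bounded
   sequences below miss none of them: see card_partitions. *)
Definition nb_partitions (n : nat) : nat :=
  #|[set s : n.-bseq 'I_n.+1 | is_partition n (map val s)]|.

Lemma is_partition_bounds n s :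
  is_partition n s -> (size s <= n) && all (fun i => i < n.+1) s.
Proof.
case/and3P=> _ s0 /eqP <-.
elim: s s0 => //= x s IHs; rewrite inE negb_or => /andP[x0 /IHs/andP[le_s lt_s]].
rewrite ltnS leq_addr /= -add1n leq_add //=; last by rewrite lt0n eq_sym.
by apply: sub_all lt_s => i /leq_trans-> //; rewrite ltnS leq_addl.
Qed.

Lemma card_partitions n (l : seq (seq nat)) :
  uniq l -> (forall s, (s \in l) = is_partition n s) ->
  nb_partitions n = size l.
Proof.
move=> Ul lP; pose f (t : n.-bseq 'I_n.+1) := map val t.
have f_inj : injective f by move=> t u /(inj_map val_inj)/val_inj.
rewrite /nb_partitions cardE -(size_map f); apply/perm_size.
apply: uniq_perm => //; first by rewrite map_inj_uniq ?enum_uniq.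
move=> s; rewrite lP; apply/mapP/idP => [[t]|sP].
  by rewrite mem_enum inE => tP ->.
have /andP[le_s lt_s] := is_partition_bounds sP.
have vK : map val (map (@inord n) s) = s.
  rewrite -map_comp -[RHS]map_id; apply/eq_in_map => i /(allP lt_s) lt_i.
  by rewrite /= inordK.
have le_t : size (map (@inord n) s) <= n by rewrite size_map.
by exists (Bseq le_t); rewrite /f /= ?mem_enum ?inE /= vK.
Qed.

(* Main.v *)
(* Write a, b, c, d for p(n-1), p(n), p(n+1), p(n+2); the claim is c(a+c) >= b(b+d).
   For n <= 6001 it is checked on a table of p computed by Euler's pentagonal
   recurrence.  For larger n the circle method is used in its elementary form.
   With q = e^-t and t > 0 the saddle point, sum_k k q^k/(1-q^k) = n-1, the
   coefficients of F(x) = prod_k 1/(1-x^k) are Fourier integrals of F(q e^(i x)).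
   Multiplying out, c(a+c) - b(b+d) is, up to a positive factor,
     (1 - e^-2t) m1^2 + M0 ((1 - e^-2t) m2 - m3) + m1 (m2 + m3) + m2^2,
   where M0, m1, m2, m3 are, up to sign, the integrals of
   F(q e^(ix)) e^(-i(n-1)x) (e^(-ix) - 1)^j.  The leading term M0 (1 - e^-2t) m2 is
   visibly positive, so only crude estimates are needed: |F| lies between two
   Gaussians of width t^(3/2) near 0, the phase defect is at most cubic, and away
   from 0 |F| is bounded through log |F(q e^(ix))/F(q)| =
   - sum_m (1/m) sum_k q^(km) (1 - cos(kmx)), keeping finitely many m. *)

From mathcomp Require Import all_boot all_order all_algebra zify.
From Stdlib Require Import ZArith Reals Ranalysis5 Psatz.
From Coquelicot Require Import Coquelicot.
Require Import Defs.

(** The products are finite, over parts at most N, so that no question of convergence arises; N is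
    of order n^2, which makes the missing tail of every exponential sum negligible while all
    partitions of the numbers involved are counted. The weight e^(-jt) carried by p(n-1+j) turns
    differences of neighbouring values into powers of e^(-ix) - 1, each worth one factor of the
    Gaussian width. In the unit h = sqrt t that width is h^3, and M0, m2 and (1 - e^(-2t)) m2 - m3
    have sizes h^3, h^9 and h^11. As m2 + m3 >= 0, m1 can only do harm through its negative part,
    which is at most h^6 / 50. So a term 0.0219 h^14 competes with 0.12 h^15, and it wins for t <=
    1/60. The bound 5 / (3 t^2) on the mean forces t <= 1/60 once n - 1 >= 6001, which is why the
    table must reach that far. The numerical constants are arranged around the cut-off 9/5 h^3:
    beyond it the Gaussian is small, below it all phases stay under pi/2. *)

Local Open Scope R_scope.

(* Sums and products over 1 <= k <= n. *)
Fixpoint psum (f : nat -> R) (n : nat) : R :=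
  match n with O => 0 | S p => psum f p + f (S p) end.

Fixpoint pprod (f : nat -> R) (n : nat) : R :=
  match n with O => 1 | S p => pprod f p * f (S p) end.

Lemma psum_le f g n : (forall k, f (S k) <= g (S k)) -> psum f n <= psum g n.
Proof. move=> le_fg; elim: n => [|n IHn] /=; [lra | have := le_fg n; lra]. Qed.

Lemma psum_ext f g n : (forall k, f (S k) = g (S k)) -> psum f n = psum g n.
Proof. by move=> eq_fg; elim: n => //= n ->; rewrite eq_fg. Qed.

Lemma psum_scal c f n : psum (fun k => c * f k) n = c * psum f n.
Proof. elim: n => [|n IHn] /=; [ring | rewrite IHn; ring]. Qed.

Lemma psum_plus f g n : psum (fun k => f k + g k) n = psum f n + psum g n.
Proof. elim: n => [|n IHn] /=; [ring | rewrite IHn; ring]. Qed.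

Lemma psum_swap f n m :
  psum (fun i => psum (fun j => f i j) m) n = psum (fun j => psum (fun i => f i j) n) m.
Proof.
elim: n => [|n IHn] /=; last by rewrite IHn -psum_plus.
by elim: m => //= m <-; ring.
Qed.

(** * The generating product on a circle, in polar coordinates *)

(* [nrm r phi] is |1 - r e^(i phi)|^2 and [- angle r phi] the argument of 1 - r e^(i phi). *)
Definition nrm (r phi : R) : R := 1 - 2 * r * cos phi + r ^ 2.

Lemma nrmE r phi : nrm r phi = (1 - r) ^ 2 + 2 * r * (1 - cos phi).
Proof. rewrite /nrm; ring. Qed.

Lemma cosB_ge0 x : 0 <= 1 - cos x.
Proof. have := COS_bound x; lra. Qed.

Lemma nrm_ge r phi : 0 <= r -> (1 - r) ^ 2 <= nrm r phi.
Proof. rewrite nrmE => r0; have := Rmult_le_pos _ _ r0 (cosB_ge0 phi); lra. Qed.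

Lemma nrm_gt0 r phi : 0 <= r < 1 -> 0 < nrm r phi.
Proof. move=> r01; have := nrm_ge r phi; nra. Qed.

Definition angle (r phi : R) : R := atan (r * sin phi / (1 - r * cos phi)).

Lemma angle_den_gt0 r phi : 0 <= r < 1 -> 0 < 1 - r * cos phi.
Proof. move=> r01; have := COS_bound phi; nra. Qed.

Lemma angle_polar r phi : 0 <= r < 1 ->
  cos (angle r phi) * sqrt (nrm r phi) = 1 - r * cos phi /\
  sin (angle r phi) * sqrt (nrm r phi) = r * sin phi.
Proof.
move=> r01; have a0 := angle_den_gt0 r phi r01.
set a := 1 - r * cos phi in a0 *; set b := r * sin phi.
have nE : nrm r phi = a ^ 2 * (1 + (b / a) ^ 2).
  have := sin2_cos2 phi; rewrite /Rsqr /nrm => sc.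
  replace (a ^ 2 * (1 + (b / a) ^ 2)) with (a ^ 2 + b ^ 2) by (field; lra).
  rewrite /a /b; nra.
have q0 : 0 < 1 + (b / a) ^ 2 by nra.
have s0 := sqrt_lt_R0 _ q0.
have sE : sqrt (nrm r phi) = a * sqrt (1 + (b / a) ^ 2).
  by rewrite nE sqrt_mult; [rewrite sqrt_pow2 //; lra | nra | lra].
rewrite /angle -/a -/b cos_atan sin_atan sE !Rsqr_pow2.
by split; field; lra.
Qed.

(** Real part of [(1 - r e^(i phi)) e^(i (alpha + angle r phi)) = sqrt (nrm r phi) e^(i alpha)]:
    multiplying by one factor of the product undoes its rotation. *)
Lemma angle_step r phi alpha : 0 <= r < 1 ->
  cos (alpha + angle r phi) - r * cos (alpha + angle r phi + phi) =
  sqrt (nrm r phi) * cos alpha.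
Proof.
move=> r01; have [ca sa] := angle_polar r phi r01.
set d := angle r phi in ca sa *; set q := sqrt _ in ca sa *.
have -> : cos (alpha + d) - r * cos (alpha + d + phi) =
          cos (alpha + d) * (1 - r * cos phi) + sin (alpha + d) * (r * sin phi).
  rewrite (cos_plus (alpha + d) phi); ring.
rewrite -ca -sa.
have -> : cos alpha = cos (alpha + d) * cos d + sin (alpha + d) * sin d.
  by rewrite -cos_minus; congr (cos _); ring.
ring.
Qed.

Definition rr (t : R) (k : nat) : R := exp (- (INR k * t)).

Lemma rr_bound t k : 0 < t -> 0 < rr t (S k) < 1.
Proof.
move=> t0; split; first exact: exp_pos.
rewrite -exp_0; apply: exp_increasing.
have := lt_0_INR (S k) (Nat.lt_0_succ k); nra.
Qed.

(* For F = prod_(k <= N) 1/(1 - x^k) and z = e^(-t + ix), [damp] is |F(z)| / F(|z|)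
   and [phase] is the argument of F(z). *)
Definition damp (N : nat) (t x : R) : R :=
  pprod (fun k => (1 - rr t k) / sqrt (nrm (rr t k) (INR k * x))) N.

Definition phase (N : nat) (t x : R) : R :=
  psum (fun k => angle (rr t k) (INR k * x)) N.

Lemma damp_gt0 N t x : 0 < t -> 0 < damp N t x.
Proof.
move=> t0; rewrite /damp; elim: N => [|N IHN] /=; first lra.
have r01 := rr_bound t N t0; apply: Rmult_lt_0_compat => //.
apply: Rdiv_lt_0_compat; first lra.
by apply/sqrt_lt_R0/nrm_gt0; lra.
Qed.

Lemma damp_le1 N t x : 0 < t -> damp N t x <= 1.
Proof.
move=> t0; elim: N => [|N IHN]; first by rewrite /damp /=; lra.
have p0 := damp_gt0 N t x t0; have r01 := rr_bound t N t0.
have n0 : 0 < nrm (rr t (S N)) (INR (S N) * x) by apply: nrm_gt0; lra.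
have q0 := sqrt_lt_R0 _ n0.
have : (1 - rr t (S N)) / sqrt (nrm (rr t (S N)) (INR (S N) * x)) <= 1.
  apply/Rle_div_l => //; rewrite Rmult_1_l -(sqrt_pow2 (1 - rr t (S N))); last lra.
  by apply/sqrt_le_1_alt/nrm_ge; lra.
have : 0 < (1 - rr t (S N)) / sqrt (nrm (rr t (S N)) (INR (S N) * x)).
  by apply: Rdiv_lt_0_compat; lra.
rewrite /damp /pprod -/pprod -/(damp N t x); nra.
Qed.

Lemma continuous_damp N t x : 0 < t -> continuous (damp N t) x.
Proof.
move=> t0; elim: N => [|N IHN]; first exact: continuous_const.
have r01 := rr_bound t N t0.
apply: (continuous_mult (damp N t)) => //.
apply/continuity_pt_filterlim/derivable_continuous_pt.
apply: ex_derive_Reals_0.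
have : 0 < nrm (rr t (S N)) (INR (S N) * x) by apply: nrm_gt0; lra.
rewrite /nrm; move: (INR (S N)) (rr t (S N)) => k r n0; auto_derive.
have q0 := sqrt_lt_R0 _ n0; rewrite /Rminus /= in n0 q0; repeat split; lra.
Qed.

Lemma is_derive_angle r phi : 0 <= r < 1 ->
  is_derive (angle r) phi ((r * cos phi - r ^ 2) / nrm r phi).
Proof.
move=> r01; have a0 := angle_den_gt0 r phi r01; have n0 := nrm_gt0 r phi r01.
rewrite /angle; auto_derive; first lra.
have sc := sin2_cos2 phi; rewrite /Rsqr in sc.
set c := cos phi in sc a0 *; set s := sin phi in sc *.
have nE : nrm r phi = (1 - r * c) ^ 2 + (r * s) ^ 2 by rewrite /nrm -/c; nra.
rewrite nE in n0 *.
have e : r * c - r ^ 2 = r * c * (1 - r * c) - (r * s) ^ 2 by nra.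
rewrite e; field; repeat split; nra.
Qed.

Lemma continuous_phase N t x : 0 < t -> continuous (phase N t) x.
Proof.
move=> t0; elim: N => [|N IHN]; first exact: continuous_const.
have r01 := rr_bound t N t0.
apply: (continuous_plus (phase N t)) => //.
apply: (continuous_comp (fun x => INR (S N) * x) (angle (rr t (S N)))).
  apply: continuous_mult; [exact: continuous_const | exact: continuous_id].
apply: ex_derive_continuous; eexists; apply: is_derive_angle; lra.
Qed.

(** * Fourier coefficients of the generating product *)

(** Running the recurrence downwards reaches the range where d is bounded, with an arbitrarily small
    factor r^j. Applied to the difference of two solutions, this replaces an expansion of the
    product into a power series. *)
Lemma bounded_geometric_eq0 (d : Z -> R) (k : nat) (r C : R) :
    (0 < k)%coq_nat -> 0 <= r < 1 ->
    (forall m, d m = r * d (m - Z.of_nat k)%Z) ->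
    (forall m, (m < 0)%Z -> Rabs (d m) <= C) ->
  forall m, d m = 0.
Proof.
move=> k0 r01 dE dC m.
have iter j : d m = r ^ j * d (m - Z.of_nat (j * k)%coq_nat)%Z.
  elim: j => [|j ->]; first by rewrite /= Rmult_1_l; congr d; lia.
  rewrite [in LHS]dE /= -Rmult_assoc (Rmult_comm (r ^ j)); congr (_ * d _); lia.
case: (Req_dec (d m) 0) => // dm0; exfalso.
have a0 : 0 < Rabs (d m) by apply: Rabs_pos_lt.
have C0 : 0 <= C.
  have := dC (-1)%Z (ltac:(lia)); have := Rabs_pos (d (-1)%Z); lra.
have e0 : 0 < Rabs (d m) / (C + 1) by apply: Rdiv_lt_0_compat; lra.
have [|J HJ] := pow_lt_1_zero r _ _ e0; first by rewrite Rabs_pos_eq; lra.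
(* Large enough for r^j to be small and, as k >= 1, for m - j k to be negative. *)
pose j := (J + Z.to_nat (Z.abs m) + 1)%coq_nat.
have rj := HJ j (ltac:(lia)).
have := dC (m - Z.of_nat (j * k)%coq_nat)%Z (ltac:(nia)).
have := Rabs_pos (d (m - Z.of_nat (j * k)%coq_nat)%Z).
have := f_equal Rabs (iter j); rewrite Rabs_mult.
have : Rabs (r ^ j) * (C + 1) < Rabs (d m).
  by apply/Rlt_div_r => //; lra.
have := Rabs_pos (r ^ j); nra.
Qed.

(** Real part of [F(z) e^(-i y x) / F(|z|)]. Conjugation exchanges x and -x, so half the circle
    carries the whole coefficient. The frequency is real because it is later given relative to
    [mean N t], known to be an integer only at the saddle point. *)
Definition wave (N : nat) (t y x : R) : R := damp N t x * cos (phase N t x - y * x).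

Lemma continuous_wave N t y x : 0 < t -> continuous (wave N t y) x.
Proof.
move=> t0; apply: (continuous_mult (damp N t)); first exact: continuous_damp.
apply: (continuous_comp (fun x => phase N t x - y * x) cos).
  apply: (continuous_minus (phase N t)); first exact: continuous_phase.
  by apply: continuous_mult; [exact: continuous_const | exact: continuous_id].
exact: continuous_cos.
Qed.

Lemma ex_RInt_cont (f : R -> R) a b : (forall x, continuous f x) -> ex_RInt f a b.
Proof. by move=> cf; apply: (ex_RInt_continuous f) => x _; exact: cf. Qed.

Lemma RInt_lin (f g : R -> R) a b c d :
    (forall x, continuous f x) -> (forall x, continuous g x) ->
  RInt (fun x => c * f x + d * g x) a b = c * RInt f a b + d * RInt g a b.
Proof.
move=> cf cg; apply: is_RInt_unique.
apply: (is_RInt_plus (fun x => c * f x) (fun x => d * g x)).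
  by apply: (is_RInt_scal f); apply: (RInt_correct f); apply: ex_RInt_cont.
by apply: (is_RInt_scal g); apply: (RInt_correct g); apply: ex_RInt_cont.
Qed.

Lemma wave_le1 N t y x : 0 < t -> Rabs (wave N t y x) <= 1.
Proof.
move=> t0; rewrite /wave Rabs_mult (Rabs_pos_eq (damp N t x)); last exact/Rlt_le/damp_gt0.
have := damp_gt0 N t x t0; have := damp_le1 N t x t0.
have : Rabs (cos (phase N t x - y * x)) <= 1 by apply/Rabs_le/COS_bound.
have := Rabs_pos (cos (phase N t x - y * x)); nra.
Qed.

Lemma RInt_cos_Z (m : Z) : (m <> 0)%Z -> RInt (fun x => cos (IZR m * x)) 0 PI = 0.
Proof.
move=> m0; have z0 : IZR m <> 0 by apply: IZR_neq.
have : is_RInt (fun x => cos (IZR m * x)) 0 PI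
         (minus (sin (IZR m * PI) / IZR m) (sin (IZR m * 0) / IZR m)).
  apply: (is_RInt_derive (fun x => sin (IZR m * x) / IZR m)) => x _.
    by auto_derive => //; field.
  apply: (continuous_comp (fun x => IZR m * x) cos); last exact: continuous_cos.
  by apply: continuous_mult; [exact: continuous_const | exact: continuous_id].
move/is_RInt_unique => ->.
rewrite Rmult_0_r sin_0 (sin_eq_0_1 (IZR m * PI)); last by exists m.
by rewrite /minus /plus /opp /=; field.
Qed.

(** Real form of [F_(N+1)(z) (1 - z^(N+1)) = F_N(z)]: the factor z^(N+1) lowers the frequency by N+1
    and scales by [rr t (S N)]; the factor on the right comes from the division by F(|z|). *)
Lemma wave_step N t (m : Z) x : 0 < t ->
  wave (S N) t (IZR m) x - rr t (S N) * wave (S N) t (IZR (m - Z.of_nat (S N))) x =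
  (1 - rr t (S N)) * wave N t (IZR m) x.
Proof.
move=> t0; have r01 := rr_bound t N t0; rewrite /wave minus_IZR -INR_IZR_INZ.
have [dE pE] : damp (S N) t x = damp N t x *
      ((1 - rr t (S N)) / sqrt (nrm (rr t (S N)) (INR (S N) * x))) /\
    phase (S N) t x = phase N t x + angle (rr t (S N)) (INR (S N) * x) by [].
rewrite dE pE; set r := rr t (S N) in r01 *; set f := INR (S N) * x.
have q0 := sqrt_lt_R0 _ (nrm_gt0 r f (ltac:(lra))).
have := angle_step r f (phase N t x - IZR m * x) (ltac:(lra)).
have -> : phase N t x - IZR m * x + angle r f = phase N t x + angle r f - IZR m * x by ring.
have -> : phase N t x + angle r f - IZR m * x + f =
          phase N t x + angle r f - (IZR m - INR (S N)) * x by rewrite /f; ring.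
set u := cos _; set v := cos _; set w := cos _ => e.
have -> : u = r * v + sqrt (nrm r f) * w by lra.
by field; lra.
Qed.

(* [pz N m] is the number of partitions of [m] into parts at most [N], extended by 0 to m < 0. *)
Theorem RInt_wave (pz : nat -> Z -> R) (t : R) :
    0 < t ->
    (forall m, pz O m = if (m =? 0)%Z then 1 else 0) ->
    (forall N m, pz (S N) m = pz N m + pz (S N) (m - Z.of_nat (S N))%Z) ->
    (forall N m, (m < 0)%Z -> pz N m = 0) ->
  forall N m, RInt (wave N t (IZR m)) 0 PI =
    PI * pprod (fun k => 1 - rr t k) N * exp (- (IZR m * t)) * pz N m.
Proof.
move=> t0 pz0 pzS pz_neg; have pi0 := PI_RGT_0; elim=> [|N IHN] m.
  have -> : RInt (wave 0 t (IZR m)) 0 PI = RInt (fun x => cos (IZR m * x)) 0 PI.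
    apply: RInt_ext => x _; rewrite /wave /damp /phase /= Rmult_1_l.
    by rewrite -(cos_neg (IZR m * x)); congr cos; ring.
  rewrite pz0 /=; case: Z.eqb_spec => [->|m0]; last by rewrite RInt_cos_Z //; ring.
  rewrite (RInt_ext _ (fun _ => 1)); last by move=> x _; rewrite Rmult_0_l cos_0.
  by rewrite RInt_const /scal /= /mult /= Rmult_0_l Ropp_0 exp_0; ring.
pose E m := PI * pprod (fun k => 1 - rr t k) (S N) * exp (- (IZR m * t)) * pz (S N) m.
pose d m := RInt (wave (S N) t (IZR m)) 0 PI - E m.
have r01 := rr_bound t N t0.
suff : d m = 0 by rewrite /d /E; lra.
move: m; apply: (bounded_geometric_eq0 d (S N) (rr t (S N)) PI); [lia | lra | | ].
- move=> m; rewrite /d.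
  have iE : RInt (wave (S N) t (IZR m)) 0 PI =
      rr t (S N) * RInt (wave (S N) t (IZR (m - Z.of_nat (S N)))) 0 PI +
      (1 - rr t (S N)) * RInt (wave N t (IZR m)) 0 PI.
    rewrite -RInt_lin => [|x|x]; try exact: continuous_wave.
    by apply: RInt_ext => x _; have := wave_step N t m x t0; lra.
  rewrite iE IHN /E (pzS N m).
  have -> : exp (- (IZR m * t)) = rr t (S N) * exp (- (IZR (m - Z.of_nat (S N)) * t)).
    by rewrite /rr -exp_plus minus_IZR -INR_IZR_INZ; congr exp; ring.
  rewrite [pprod _ (S N)]/= -/pprod; ring.
- move=> m m0; rewrite /d /E pz_neg // Rmult_0_r Rminus_0_r.
  suff : Rabs (RInt (wave (S N) t (IZR m)) 0 PI) <= (PI - 0) * 1 by lra.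
  apply: abs_RInt_le_const; [lra | by apply: ex_RInt_cont => x; apply: continuous_wave |].
  by move=> x _; apply: wave_le1.
Qed.

(** * Taylor inequalities obtained by integrating signs *)

Lemma is_derive_ge0_le (f f' : R -> R) a b : a <= b ->
    (forall x, a <= x <= b -> is_derive f x (f' x)) ->
    (forall x, a <= x <= b -> 0 <= f' x) ->
  f a <= f b.
Proof.
move=> ab df f'0; have [c|c|c [/= cab e]] := MVT_gen f a b f'.
- by rewrite Rmin_left // Rmax_right // => cab; apply: df; lra.
- rewrite Rmin_left // Rmax_right // => cab.
  by apply/continuity_pt_filterlim/ex_derive_continuous; eexists; apply: df.
- move: cab; rewrite Rmin_left // Rmax_right // => cab.
  by have := f'0 c cab; nra.
Qed.

Lemma exp_le_compat x y : x <= y -> exp x <= exp y.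
Proof. by case=> [/exp_increasing|->]; lra. Qed.

Lemma sin_le_id x : 0 <= x -> sin x <= x.
Proof.
move=> x0; suff : 0 - sin 0 <= x - sin x by rewrite sin_0; lra.
apply: (is_derive_ge0_le (fun y => y - sin y) (fun y => 1 - cos y)) => // y _.
  by auto_derive => //; ring.
exact: cosB_ge0.
Qed.

Lemma cosB_le_sqr x : 1 - cos x <= x ^ 2 / 2.
Proof.
have pos y : 0 <= y -> 1 - cos y <= y ^ 2 / 2.
  move=> y0; suff : 0 ^ 2 / 2 + cos 0 <= y ^ 2 / 2 + cos y by rewrite cos_0; lra.
  apply: (is_derive_ge0_le (fun y => y ^ 2 / 2 + cos y) (fun y => y - sin y)) => // z [z0 _].
    by auto_derive => //; field.
  by have := sin_le_id z z0; lra.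
case: (Rle_dec 0 x) => x0; first exact: pos.
by rewrite -cos_neg; have := pos (- x) (ltac:(lra)); nra.
Qed.

Lemma sin_ge_cubic x : 0 <= x -> x - x ^ 3 / 6 <= sin x.
Proof.
move=> x0; suff : sin 0 - (0 - 0 ^ 3 / 6) <= sin x - (x - x ^ 3 / 6) by rewrite sin_0; lra.
apply: (is_derive_ge0_le (fun y => sin y - (y - y ^ 3 / 6)) (fun y => cos y - 1 + y ^ 2 / 2)).
- by [].
- by move=> y _; auto_derive => //; field.
- by move=> y _; have := cosB_le_sqr y; lra.
Qed.

Lemma angle0 r : angle r 0 = 0.
Proof. by rewrite /angle sin_0 Rmult_0_r /Rdiv Rmult_0_l atan_0. Qed.

Lemma angle_slope r phi : 0 <= r < 1 ->
  r / (1 - r) - (r * cos phi - r ^ 2) / nrm r phi =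
  r * (1 + r) * (1 - cos phi) / ((1 - r) * nrm r phi).
Proof.
move=> r01; have := nrm_gt0 r phi r01; rewrite /nrm => n0.
by field; split; lra.
Qed.

(* The derivative of the defect is nonnegative and at most quadratic, by [angle_slope]. *)
Lemma angle_defect_bounds r phi : 0 <= r < 1 -> 0 <= phi ->
  0 <= phi * (r / (1 - r)) - angle r phi <= phi ^ 3 / 6 * (r * (1 + r) / (1 - r) ^ 3).
Proof.
move=> r01 phi0.
have slope y : 0 <= r * (1 + r) * (1 - cos y) / ((1 - r) * nrm r y) <=
    y ^ 2 / 2 * (r * (1 + r) / (1 - r) ^ 3).
  have n0 := nrm_gt0 r y r01; have n1 := nrm_ge r y (proj1 r01).
  have u0 := cosB_ge0 y; have u1 := cosB_le_sqr y.
  split.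
    by apply: Rdiv_le_0_compat; [apply: Rmult_le_pos; nra | apply: Rmult_lt_0_compat; lra].
  have -> : y ^ 2 / 2 * (r * (1 + r) / (1 - r) ^ 3) =
            r * (1 + r) * (y ^ 2 / 2) / ((1 - r) * (1 - r) ^ 2) by field; lra.
  apply: Rmult_le_compat.
  - by apply: Rmult_le_pos; nra.
  - by apply/Rlt_le/Rinv_0_lt_compat/Rmult_lt_0_compat; lra.
  - by apply: Rmult_le_compat_l; nra.
  - apply: Rinv_le_contravar; last by apply: Rmult_le_compat_l; lra.
    by apply: Rmult_lt_0_compat; nra.
pose f x := x * (r / (1 - r)) - angle r x.
have f0 : f 0 = 0 by rewrite /f angle0; ring.
have df y : is_derive f y (r * (1 + r) * (1 - cos y) / ((1 - r) * nrm r y)).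
  rewrite -angle_slope // /f.
  apply: (is_derive_minus (fun x => x * (r / (1 - r))) (angle r)); last exact: is_derive_angle.
  by auto_derive => //; ring.
rewrite -/(f phi); split.
  rewrite -f0; apply: (is_derive_ge0_le f _ 0 phi phi0) => [y _|y _]; first exact: df.
  by have := slope y; lra.
pose c := r * (1 + r) / (1 - r) ^ 3; rewrite -/c in slope *.
suff : 0 ^ 3 / 6 * c - f 0 <= phi ^ 3 / 6 * c - f phi by rewrite f0; lra.
apply: (is_derive_ge0_le (fun x => x ^ 3 / 6 * c - f x)
  (fun y => y ^ 2 / 2 * c - r * (1 + r) * (1 - cos y) / ((1 - r) * nrm r y)) 0 phi phi0).
  move=> y _; apply: (is_derive_minus (fun x => x ^ 3 / 6 * c) f); last exact: df.
  by auto_derive => //; field.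
by move=> y _; have := slope y; lra.
Qed.

(* The first three cumulants of the number partitioned by a random partition, i.e.
   derivatives of log F(e^-t). *)
Definition mean (N : nat) (t : R) : R := psum (fun k => INR k * (rr t k / (1 - rr t k))) N.

Definition var (N : nat) (t : R) : R := psum (fun k => INR k ^ 2 * (rr t k / (1 - rr t k) ^ 2)) N.

Definition cum3 (N : nat) (t : R) : R :=
  psum (fun k => INR k ^ 3 * (rr t k * (1 + rr t k) / (1 - rr t k) ^ 3)) N.

Lemma phase_defect_bounds N t x : 0 < t -> 0 <= x ->
  0 <= mean N t * x - phase N t x <= cum3 N t * x ^ 3 / 6.
Proof.
move=> t0 x0; elim: N => [|N [lo up]]; first by rewrite /mean /phase /cum3 /=; lra.
have r01 := rr_bound t N t0; have k0 := pos_INR (S N).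
have [|lo1 up1] := angle_defect_bounds (rr t (S N)) (INR (S N) * x) (ltac:(lra)).
  exact: Rmult_le_pos.
have [mE [pE cE]] : mean (S N) t = mean N t + INR (S N) * (rr t (S N) / (1 - rr t (S N))) /\
    phase (S N) t x = phase N t x + angle (rr t (S N)) (INR (S N) * x) /\
    cum3 (S N) t = cum3 N t +
      INR (S N) ^ 3 * (rr t (S N) * (1 + rr t (S N)) / (1 - rr t (S N)) ^ 3) by [].
rewrite mE pE cE; move: lo1 up1; set c := _ / (1 - _) ^ 3; set d := rr _ _ / _.
move: (INR (S N)) (angle _ _) => k a lo1 up1; split; nra.
Qed.

Lemma damp_factor_ge r phi g : 0 < r < 1 ->
  nrm r phi <= (1 - r) ^ 2 * exp (2 * g) -> exp (- g) <= (1 - r) / sqrt (nrm r phi).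
Proof.
move=> r01 le_n; have n0 := nrm_gt0 r phi (ltac:(lra)); have q0 := sqrt_lt_R0 _ n0.
apply/Rle_div_r => //; have e0 := exp_pos g.
have -> : 1 - r = exp (- g) * ((1 - r) * exp g).
  by rewrite exp_Ropp; field; lra.
apply: Rmult_le_compat_l; first exact/Rlt_le/exp_pos.
rewrite -(sqrt_pow2 ((1 - r) * exp g)); last by nra.
apply: sqrt_le_1_alt; apply: Rle_trans le_n _.
have -> : 2 * g = g + g by ring.
by rewrite exp_plus; right; ring.
Qed.

Lemma damp_factor_le r phi g : 0 < r < 1 ->
  (1 - r) ^ 2 * exp (2 * g) <= nrm r phi -> (1 - r) / sqrt (nrm r phi) <= exp (- g).
Proof.
move=> r01 le_n; have n0 := nrm_gt0 r phi (ltac:(lra)); have q0 := sqrt_lt_R0 _ n0.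
apply/Rle_div_l => //; have e0 := exp_pos g.
have {1}-> : 1 - r = exp (- g) * ((1 - r) * exp g).
  by rewrite exp_Ropp; field; lra.
apply: Rmult_le_compat_l; first exact/Rlt_le/exp_pos.
rewrite -(sqrt_pow2 ((1 - r) * exp g)); last by nra.
apply: sqrt_le_1_alt; apply: Rle_trans le_n.
have -> : 2 * g = g + g by ring.
by rewrite exp_plus; right; ring.
Qed.

Lemma damp_le_exp N t x (g : nat -> R) : 0 < t ->
    (forall k, (1 - rr t (S k)) ^ 2 * exp (2 * g (S k)) <= nrm (rr t (S k)) (INR (S k) * x)) ->
  damp N t x <= exp (- psum g N).
Proof.
move=> t0 le_g; elim: N => [|N IHN]; first by rewrite /damp /= Ropp_0 exp_0; lra.
have -> : damp (S N) t x = damp N t x *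
    ((1 - rr t (S N)) / sqrt (nrm (rr t (S N)) (INR (S N) * x))) by [].
rewrite /psum -/psum Ropp_plus_distr exp_plus.
have r01 := rr_bound t N t0.
have := damp_factor_le _ _ _ r01 (le_g N); have := damp_gt0 N t x t0.
have := Rdiv_lt_0_compat (1 - rr t (S N)) _ (ltac:(lra))
          (sqrt_lt_R0 _ (nrm_gt0 (rr t (S N)) (INR (S N) * x) (ltac:(lra)))).
by move=> *; apply: Rmult_le_compat => //; lra.
Qed.

(** Factor by factor, [nrm / (1 - r)^2 = 1 + 2 r (1 - cos (k x)) / (1 - r)^2] is at most the
    exponential of [(k x)^2 r / (1 - r)^2]; half of these exponents add up to
    [var N t * x ^ 2 / 2]. *)
Lemma damp_ge_gauss N t x : 0 < t -> exp (- (var N t * x ^ 2 / 2)) <= damp N t x.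
Proof.
move=> t0; elim: N => [|N IHN].
  by rewrite /damp /var /= Rmult_0_l /Rdiv Rmult_0_l Ropp_0 exp_0; lra.
have -> : damp (S N) t x = damp N t x *
    ((1 - rr t (S N)) / sqrt (nrm (rr t (S N)) (INR (S N) * x))) by [].
have -> : var (S N) t = var N t + INR (S N) ^ 2 * (rr t (S N) / (1 - rr t (S N)) ^ 2) by [].
have r01 := rr_bound t N t0; set r := rr t (S N) in r01 *; set k := INR (S N).
have -> : - ((var N t + k ^ 2 * (r / (1 - r) ^ 2)) * x ^ 2 / 2) =
    - (var N t * x ^ 2 / 2) + - ((k * x) ^ 2 / 2 * (r / (1 - r) ^ 2)) by field; lra.
rewrite exp_plus; apply: Rmult_le_compat => //; try exact/Rlt_le/exp_pos.
apply: damp_factor_ge => //; rewrite nrmE.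
have -> : 2 * ((k * x) ^ 2 / 2 * (r / (1 - r) ^ 2)) = (k * x) ^ 2 * r / (1 - r) ^ 2.
  by field; lra.
have := exp_ineq1_le ((k * x) ^ 2 * r / (1 - r) ^ 2) => e1.
have := Rmult_le_compat_l _ _ _ (pow2_ge_0 (1 - r)) e1.
have -> : (1 - r) ^ 2 * (1 + (k * x) ^ 2 * r / (1 - r) ^ 2) = (1 - r) ^ 2 + (k * x) ^ 2 * r.
  by field; lra.
by have := cosB_le_sqr (k * x); nra.
Qed.

(** The difference of cosines is the real part of [e^(i M phi) (e^(i phi) - r)], whose modulus is
    [sqrt (nrm r phi)]; and 1 - r is at most that modulus too. *)
Lemma poisson_num_le r phi M : 0 <= r < 1 ->
  Rabs (cos (INR (S M) * phi) - r * cos (INR M * phi)) * (1 - r) <= nrm r phi.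
Proof.
move=> r01; rewrite S_INR Rmult_plus_distr_r Rmult_1_l.
set a := INR M * phi.
have e : nrm r phi = (cos (a + phi) - r * cos a) ^ 2 + (sin (a + phi) - r * sin a) ^ 2.
  have := sin2_cos2 (a + phi); have := sin2_cos2 a; rewrite /Rsqr /nrm => e1 e2.
  have -> : cos phi = cos (a + phi) * cos a + sin (a + phi) * sin a.
    by rewrite -cos_minus; congr cos; ring.
  by nra.
have n1 := nrm_ge r phi (proj1 r01).
set c := _ - _ in e *; have c2 : c ^ 2 <= nrm r phi.
  by rewrite e; have := pow2_ge_0 (sin (a + phi) - r * sin a); lra.
have cc : Rabs c ^ 2 = c ^ 2 by rewrite pow2_abs.
have := Rabs_pos c; have := nrm_gt0 r phi r01; nra.
Qed.

(* Real part of 1/(1 - r) - e^(i (M+1) phi) / (1 - r e^(i phi)), the remainder of the series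
   sum_m r^m (1 - cos ((m+1) phi)) after M terms. *)
Definition poisson (r phi : R) (M : nat) : R :=
  1 / (1 - r) - (cos (INR (S M) * phi) - r * cos (INR M * phi)) / nrm r phi.

Lemma poisson_bounds r phi M : 0 <= r < 1 -> 0 <= poisson r phi M <= 2 / (1 - r).
Proof.
move=> r01; have n0 := nrm_gt0 r phi r01.
have := poisson_num_le r phi M r01; rewrite /poisson; set c := _ - r * _ => le_n.
have q0 : 0 < / (1 - r) by apply: Rinv_0_lt_compat; lra.
have : Rabs (c / nrm r phi) <= 1 / (1 - r).
  rewrite Rabs_div; last lra.
  rewrite (Rabs_pos_eq (nrm r phi)); last lra.
  apply/Rle_div_l => //.
  have -> : 1 / (1 - r) * nrm r phi = nrm r phi / (1 - r) by field; lra.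
  by apply/Rle_div_r; lra.
by rewrite /Rdiv => /Rabs_le_between; lra.
Qed.

(** The powers r^(m-1) are those of the derivative in r of the logarithmic series; geometric
    summation leaves r^M times a bounded function. *)
Lemma psum_cosB r phi M : 0 <= r < 1 ->
  psum (fun m => r ^ m.-1 * (1 - cos (INR m * phi))) M =
  poisson r phi 0 - r ^ M * poisson r phi M.
Proof.
move=> r01; elim: M => [|M IHM]; first by rewrite /= ; ring.
rewrite [psum _ _]/= -/psum IHM /poisson; have := nrm_gt0 r phi r01.
have -> : INR (S (S M)) * phi = INR (S M) * phi + phi by rewrite (S_INR (S M)); ring.
have -> : INR M * phi = INR (S M) * phi - phi by rewrite (S_INR M); ring.
set a := INR (S M) * phi; set b := cos (INR 1 * phi); set c := cos (INR 0 * phi).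
rewrite cos_plus cos_minus /nrm [r ^ S M]/= => n0.
by field; split; lra.
Qed.

(* Truncation of log |1 - r e^(i phi)| - log (1 - r) = sum_m r^m (1 - cos (m phi)) / m:
   the remainder has derivative [x ^ M * poisson x phi M >= 0]. *)
Lemma log_nrm_ge r phi M : 0 <= r < 1 ->
  psum (fun m => / INR m * (r ^ m * (1 - cos (INR m * phi)))) M <=
  ln (nrm r phi) / 2 - ln (1 - r).
Proof.
move=> [r0 r1].
pose S' x := psum (fun m => / INR m * (x ^ m * (1 - cos (INR m * phi)))) M.
pose f x := ln (nrm x phi) / 2 - ln (1 - x) - S' x.
have f0 : f 0 = 0.
  have S0 n : psum (fun m => / INR m * (0 ^ m * (1 - cos (INR m * phi)))) n = 0.
    by elim: n => [//|n IHn]; rewrite [psum _ _]/= -/psum IHn /=; ring.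
  rewrite /f /S' S0.
  have [-> ->] : nrm 0 phi = 1 /\ 1 - 0 = 1 by rewrite /nrm; split; ring.
  by rewrite ln_1; lra.
have dS x : is_derive S' x (psum (fun m => x ^ m.-1 * (1 - cos (INR m * phi))) M).
  rewrite /S'; elim: (M) => [|M' IH]; first exact: is_derive_const.
  apply: (is_derive_plus (fun x => psum _ M')) => //.
  move: (cos _) => c; have k0 := not_0_INR (S M') (ltac:(lia)).
  move: k0; rewrite -pred_Sn => k0; auto_derive => //=; rewrite /= in k0.
  by field.
suff : f 0 <= f r by rewrite f0 /f -/(S' r); lra.
apply: (is_derive_ge0_le f (fun x => x ^ M * poisson x phi M) 0 r r0) => x xr; last first.
  have [p0 _] := poisson_bounds x phi M (ltac:(lra)).
  by apply: Rmult_le_pos => //; apply: pow_le; lra.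
have x01 : 0 <= x < 1 by lra.
have -> : x ^ M * poisson x phi M =
    poisson x phi 0 - psum (fun m => x ^ m.-1 * (1 - cos (INR m * phi))) M.
  by rewrite psum_cosB //; ring.
apply: (is_derive_minus (fun x => ln (nrm x phi) / 2 - ln (1 - x)) S') => //.
have n0 := nrm_gt0 x phi x01.
rewrite /poisson /= !Rmult_1_l Rmult_0_l cos_0 /nrm.
auto_derive; first by rewrite /nrm /= in n0; repeat split; lra.
by rewrite /nrm in n0; rewrite /=; field; repeat split; lra.
Qed.

Lemma rr_pow t k m : rr t k ^ m = rr (INR m * t) k.
Proof.
rewrite /rr; elim: m => [|m IHm].
  by rewrite /= Rmult_0_l Rmult_0_r Ropp_0 exp_0.
by rewrite S_INR -tech_pow_Rmult IHm -exp_plus; congr exp; ring.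
Qed.

(** The logarithm of every factor is truncated after M terms and the two sums are exchanged. For
    fixed m the inner sum is one and the same kernel at the dilated point (m t, m x), so a single
    closed form serves all m. *)
Lemma damp_le_kernel N t x M : 0 < t ->
  damp N t x <= exp (- psum (fun m => / INR m *
     psum (fun k => rr (INR m * t) k * (1 - cos (INR k * (INR m * x)))) N) M).
Proof.
move=> t0.
pose g k := psum (fun m => / INR m * (rr t k ^ m * (1 - cos (INR m * (INR k * x))))) M.
apply: Rle_trans (damp_le_exp N t x g t0 _) _ => [k|].
  have r01 := rr_bound t k t0.
  have n0 := nrm_gt0 (rr t (S k)) (INR (S k) * x) (ltac:(lra)).
  have := log_nrm_ge (rr t (S k)) (INR (S k) * x) M (ltac:(lra)); rewrite -/(g (S k)) => le_g.
  have -> : (1 - rr t (S k)) ^ 2 = exp (2 * ln (1 - rr t (S k))).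
    have -> : 2 * ln (1 - rr t (S k)) = ln (1 - rr t (S k)) + ln (1 - rr t (S k)) by ring.
    by rewrite exp_plus exp_ln; [ring | lra].
  rewrite -exp_plus -[X in _ <= X]exp_ln //.
  by apply: exp_le_compat; lra.
right; congr (exp (- _)); rewrite /g psum_swap; apply: psum_ext => m.
rewrite -psum_scal; apply: psum_ext => k; congr (_ * (_ * (1 - cos _))); last by ring.
by rewrite rr_pow.
Qed.

(** * Decay of the generating product away from the real axis *)

Lemma cosB_ge_quartic x : 0 <= x -> x ^ 2 / 2 - x ^ 4 / 24 <= 1 - cos x.
Proof.
move=> x0.
suff : 1 - cos 0 - (0 ^ 2 / 2 - 0 ^ 4 / 24) <= 1 - cos x - (x ^ 2 / 2 - x ^ 4 / 24).
  by rewrite cos_0; lra.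
apply: (is_derive_ge0_le (fun y => 1 - cos y - (y ^ 2 / 2 - y ^ 4 / 24))
  (fun y => sin y - (y - y ^ 3 / 6))) => // y [y0 _].
  by auto_derive => //; field.
by have := sin_ge_cubic y y0; lra.
Qed.

(** The second derivative e^z + e^-z is at most 8/7 + 1 < 12/5 here. The quartic bound that follows
    integrates this one twice more; arguments up to 3 t <= 1/20 will occur. *)
Lemma cosh2_le_quad y : 0 <= y <= 1 / 8 -> exp y + exp (- y) <= 2 + 6 / 5 * y ^ 2.
Proof.
move=> y01.
have c z : 0 <= z <= 1 / 8 -> exp z + exp (- z) <= 12 / 5.
  move=> z01; have e1 : exp (- z) <= 1 by rewrite -exp_0; apply: exp_le_compat; lra.
  have := exp_ineq1_le (- z); rewrite exp_Ropp => e2.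
  have p := exp_pos z; have : exp z * / exp z = 1 by apply: Rinv_r; lra.
  have := Rmult_le_compat_l (exp z) _ _ (Rlt_le _ _ p) e2.
  by rewrite exp_Ropp in e1 *; nra.
have s z : 0 <= z <= 1 / 8 -> exp z - exp (- z) <= 12 / 5 * z.
  move=> z01.
  suff : 12 / 5 * 0 - (exp 0 - exp (- 0)) <= 12 / 5 * z - (exp z - exp (- z)).
    by rewrite Ropp_0 exp_0; lra.
  apply: (is_derive_ge0_le (fun z => 12 / 5 * z - (exp z - exp (- z)))
    (fun z => 12 / 5 - (exp z + exp (- z)))) => [|w _|w w01]; first lra.
    by auto_derive => //; field.
  by have := c w (ltac:(lra)); lra.
suff : 6 / 5 * 0 ^ 2 - (exp 0 + exp (- 0)) <= 6 / 5 * y ^ 2 - (exp y + exp (- y)).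
  by rewrite Ropp_0 exp_0; lra.
apply: (is_derive_ge0_le (fun z => 6 / 5 * z ^ 2 - (exp z + exp (- z)))
  (fun z => 12 / 5 * z - (exp z - exp (- z)))) => [|w _|w w01]; first lra.
  by auto_derive => //; field.
by have := s w (ltac:(lra)); lra.
Qed.

Lemma cosh2_le_quartic y : 0 <= y <= 1 / 8 -> exp y + exp (- y) - 2 <= y ^ 2 * (1 + y ^ 2 / 10).
Proof.
move=> y01.
have s z : 0 <= z <= 1 / 8 -> exp z - exp (- z) <= 2 * z + 2 / 5 * z ^ 3.
  move=> z01.
  suff : 2 * 0 + 2 / 5 * 0 ^ 3 - (exp 0 - exp (- 0)) <= 2 * z + 2 / 5 * z ^ 3 - (exp z - exp (- z)).
    by rewrite Ropp_0 exp_0; lra.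
  apply: (is_derive_ge0_le (fun z => 2 * z + 2 / 5 * z ^ 3 - (exp z - exp (- z)))
    (fun z => 2 + 6 / 5 * z ^ 2 - (exp z + exp (- z)))) => [|w _|w w01]; first lra.
    by auto_derive => //; field.
  by have := cosh2_le_quad w (ltac:(lra)); lra.
suff : 0 ^ 2 * (1 + 0 ^ 2 / 10) - (exp 0 + exp (- 0) - 2) <=
       y ^ 2 * (1 + y ^ 2 / 10) - (exp y + exp (- y) - 2).
  by rewrite Ropp_0 exp_0; lra.
apply: (is_derive_ge0_le (fun y => y ^ 2 * (1 + y ^ 2 / 10) - (exp y + exp (- y) - 2))
  (fun z => 2 * z + 2 / 5 * z ^ 3 - (exp z - exp (- z)))) => [|w _|w w01]; first lra.
  by auto_derive => //; field.
by have := s w (ltac:(lra)); lra.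
Qed.

Lemma expN_lt1 y : 0 < y -> 0 < exp (- y) < 1.
Proof.
by move=> y0; split; [exact: exp_pos | rewrite -exp_0; apply: exp_increasing; lra].
Qed.

Lemma coth_ge y : 0 < y -> 2 / y <= (1 + exp (- y)) / (1 - exp (- y)).
Proof.
move=> y0; have e01 := expN_lt1 y y0.
have : 0 * (1 + exp (- 0)) - 2 * (1 - exp (- 0)) <= y * (1 + exp (- y)) - 2 * (1 - exp (- y)).
  apply: (is_derive_ge0_le (fun y => y * (1 + exp (- y)) - 2 * (1 - exp (- y)))
    (fun y => 1 - exp (- y) * (1 + y))) => [|w _|w w0]; first lra.
    by auto_derive => //; ring.
  have := exp_ineq1_le w; rewrite exp_Ropp; have := exp_pos w => e0 e1.
  have : / exp w * (1 + w) <= / exp w * exp w.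
    by apply: Rmult_le_compat_l => //; apply/Rlt_le/Rinv_0_lt_compat.
  by rewrite Rinv_l; lra.
rewrite Ropp_0 exp_0 => h.
apply: (proj1 (Rle_div_r (2 / y) (1 + exp (- y)) (1 - exp (- y)) (ltac:(lra)))).
have -> : 2 / y * (1 - exp (- y)) = (2 * (1 - exp (- y))) / y by field; lra.
by apply/Rle_div_l; lra.
Qed.

(* The closed form of the full sum is (coth (y/2) / 2) s / (z + s) with s = 2 (1 - cos phi) and
   z = e^y + e^-y - 2, hence at least 1 / (y (1 + q)) as soon as z <= q s. *)
Lemma kernel_sum_ge (y phi q : R) (N : nat) : 0 < y -> 0 <= q ->
    (exp y + exp (- y) - 2) <= q * (2 * (1 - cos phi)) ->
  1 / y / (1 + q) - 2 * exp (- y) ^ N / (1 - exp (- y)) <=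
  psum (fun k => rr y k * (1 - cos (INR k * phi))) N.
Proof.
move=> y0 q0 le_q; set x := exp (- y) in le_q *.
have x01 : 0 < x < 1 := expN_lt1 y y0.
have -> : psum (fun k => rr y k * (1 - cos (INR k * phi))) N =
          x * psum (fun m => x ^ m.-1 * (1 - cos (INR m * phi))) N.
  rewrite -psum_scal; apply: psum_ext => k; rewrite -Rmult_assoc; congr (_ * _).
  have e : rr y 1 = x by rewrite /rr /x /= Rmult_1_l.
  rewrite -e [k.+1.-1]/= tech_pow_Rmult rr_pow /rr; congr exp.
  by rewrite [INR 1]/=; ring.
rewrite psum_cosB; last lra.
have [p0 p1] := poisson_bounds x phi N (ltac:(lra)).
have xN0 : 0 < x ^ N by apply: pow_lt; lra.
have n0 := nrm_gt0 x phi (ltac:(lra)); have u0 := cosB_ge0 phi.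
suff : 1 / y / (1 + q) <= x * poisson x phi 0.
  have : x ^ N * poisson x phi N <= x ^ N * (2 / (1 - x)) by apply: Rmult_le_compat_l; lra.
  have -> : 2 * x ^ N / (1 - x) = x ^ N * (2 / (1 - x)) by field; lra.
  have : 0 <= x ^ N * poisson x phi N by apply: Rmult_le_pos; lra.
  nra.
have yx : exp y * x = 1 by rewrite /x -exp_plus Rplus_opp_r exp_0.
have le_x : (1 - x) ^ 2 <= q * (2 * x * (1 - cos phi)) by nra.
have -> : x * poisson x phi 0 = (1 + x) / (1 - x) * (x * (1 - cos phi) / nrm x phi).
  rewrite /poisson /= Rmult_1_l Rmult_0_l cos_0; rewrite /nrm in n0 *.
  by field; split; lra.
have c1 := coth_ge y y0; rewrite -/x in c1.
have c2 : / (1 + q) / 2 <= x * (1 - cos phi) / nrm x phi.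
  apply: (proj1 (Rle_div_r _ _ (nrm x phi) n0)); rewrite nrmE.
  have -> : / (1 + q) / 2 * ((1 - x) ^ 2 + 2 * x * (1 - cos phi)) =
            ((1 - x) ^ 2 + 2 * x * (1 - cos phi)) / (2 * (1 + q)) by field; lra.
  by apply/Rle_div_l; nra.
have -> : 1 / y / (1 + q) = 2 / y * (/ (1 + q) / 2) by field; lra.
apply: Rmult_le_compat => //.
  by apply: Rdiv_le_0_compat; lra.
by apply: Rdiv_le_0_compat; last lra; apply/Rlt_le/Rinv_0_lt_compat; lra.
Qed.

(* Error made in [kernel_sum_ge] by using finitely many parts. *)
Definition tail_small (N : nat) (t : R) : Prop := 2 * exp (- t) ^ N / (1 - exp (- t)) <= 1 / 1000.

Lemma kernel_sum_ge_small (y phi q t : R) (N : nat) : 0 < t <= y -> 0 <= q -> tail_small N t ->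
    (exp y + exp (- y) - 2) <= q * (2 * (1 - cos phi)) ->
  1 / y / (1 + q) - 1 / 1000 <= psum (fun k => rr y k * (1 - cos (INR k * phi))) N.
Proof.
move=> ty q0 small le_q.
apply: Rle_trans (kernel_sum_ge y phi q N (ltac:(lra)) q0 le_q).
suff : 2 * exp (- y) ^ N / (1 - exp (- y)) <= 2 * exp (- t) ^ N / (1 - exp (- t)).
  by move: small; rewrite /tail_small; lra.
have e1 := expN_lt1 y (ltac:(lra)); have e2 := expN_lt1 t (ltac:(lra)).
have le_e : exp (- y) <= exp (- t) by apply: exp_le_compat; lra.
have p1 : 0 < exp (- y) ^ N by apply: pow_lt; lra.
have p2 : exp (- y) ^ N <= exp (- t) ^ N by apply: pow_incr; lra.
rewrite /Rdiv; apply: Rmult_le_compat; try lra.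
  by apply/Rlt_le/Rinv_0_lt_compat; lra.
by apply: Rinv_le_contravar; lra.
Qed.

Lemma damp_le_mid N t x q : 0 < t -> 0 <= q -> tail_small N t ->
    (exp t + exp (- t) - 2) <= q * (2 * (1 - cos x)) ->
  damp N t x <= exp (2 / 1000 - 1 / t / (1 + q)).
Proof.
move=> t0 q0 small le_q; apply: Rle_trans (damp_le_kernel N t x 1 t0) _.
apply: exp_le_compat; rewrite /= !Rmult_1_l Rplus_0_l Rinv_1 Rmult_1_l.
by have := kernel_sum_ge_small t x q t N (ltac:(lra)) q0 small le_q; lra.
Qed.

(** Three kernel terms are kept: term m has a factor 1/m from the logarithm and 1/m from the closed
    form, and 1 + 1/4 + 1/9 = 49/36. The errors 1/1000, weighted by 1/m, add up to less than 2/1000.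
    The ratio 2001/2000 absorbs the quartic corrections of cosh and cos, the latter being (1/400) /
    12 = 1/4800. *)
Lemma damp_le_near N t x : 0 < t <= 1 / 60 -> 0 < x <= t -> tail_small N t ->
  damp N t x <= exp (2 / 1000 - 49 / 36 / t * (x ^ 2 / (x ^ 2 + 2001 / 2000 * t ^ 2))).
Proof.
move=> t01 xt small; pose q := 2001 / 2000 * t ^ 2 / x ^ 2.
have q0 : 0 <= q by apply: Rdiv_le_0_compat; nra.
have qx : q * x ^ 2 = 2001 / 2000 * t ^ 2 by rewrite /q; field; lra.
have term m : 1 <= m <= 3 ->
    1 / (m * t) / (1 + q) - 1 / 1000 <=
    psum (fun k => rr (m * t) k * (1 - cos (INR k * (m * x)))) N.
  move=> m13; apply: (kernel_sum_ge_small _ _ _ t) => //; first nra.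
  have mt : 0 <= m * t <= 1 / 20 by nra.
  have mx : 0 <= m * x <= 1 / 20 by nra.
  apply: Rle_trans (_ : (m * t) ^ 2 * (1 + (m * t) ^ 2 / 10) <= _).
    by apply: cosh2_le_quartic; lra.
  have := cosB_ge_quartic (m * x) (proj1 mx) => c1.
  have c2 : (m * x) ^ 2 * (1 - 1 / 4800) <= 2 * (1 - cos (m * x)).
    have : (m * x) ^ 2 <= 1 / 400 by nra.
    by have := pow2_ge_0 (m * x); nra.
  apply: Rle_trans (Rmult_le_compat_l _ _ _ q0 c2).
  have -> : q * ((m * x) ^ 2 * (1 - 1 / 4800)) = (q * x ^ 2) * m ^ 2 * (1 - 1 / 4800) by ring.
  rewrite qx.
  have : (m * t) ^ 2 <= 1 / 400 by nra.
  by have := pow2_ge_0 (m * t); nra.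
apply: Rle_trans (damp_le_kernel N t x 3 (proj1 t01)) _.
apply: exp_le_compat; rewrite [psum _ 3]/= Rplus_0_l.
have := term 1 (ltac:(lra)); have := term (1 + 1) (ltac:(lra)); have := term (1 + 1 + 1) (ltac:(lra)).
set s1 := psum _ _; set s2 := psum _ _; set s3 := psum _ _ => h3 h2 h1.
have e1 : 1 / (1 * t) / (1 + q) = 1 / t / (1 + q) by field; lra.
have e2 : 1 / ((1 + 1) * t) / (1 + q) = 1 / t / (1 + q) / 2 by field; lra.
have e3 : 1 / ((1 + 1 + 1) * t) / (1 + q) = 1 / t / (1 + q) / 3 by field; lra.
have -> : 49 / 36 / t * (x ^ 2 / (x ^ 2 + 2001 / 2000 * t ^ 2)) =
          49 / 36 * (1 / t / (1 + q)).
  rewrite /q; field; repeat split; nra.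
rewrite e1 in h1; rewrite e2 in h2; rewrite e3 in h3; lra.
Qed.

(** In this range the denominator of [damp_le_near] is at most (4/25 + 2001/2000) t^2; 117/100 is
    49/36 divided by that constant, rounded down. *)
Lemma damp_le_gauss N t x : 0 < t <= 1 / 60 -> 0 < x <= 2 / 5 * t -> tail_small N t ->
  damp N t x <= exp (2 / 1000) * exp (- (117 / 100 * x ^ 2 / t ^ 3)).
Proof.
move=> t01 xt small; apply: Rle_trans (damp_le_near N t x t01 (ltac:(lra)) small) _.
rewrite -exp_plus; apply: exp_le_compat.
suff : 117 / 100 * x ^ 2 / t ^ 3 <= 49 / 36 / t * (x ^ 2 / (x ^ 2 + 2001 / 2000 * t ^ 2)) by lra.
have d0 : 0 < x ^ 2 + 2001 / 2000 * t ^ 2 by nra.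
have -> : 117 / 100 * x ^ 2 / t ^ 3 = x ^ 2 / t * (117 / 100 * / t ^ 2) by field; lra.
have -> : 49 / 36 / t * (x ^ 2 / (x ^ 2 + 2001 / 2000 * t ^ 2)) =
  x ^ 2 / t * (49 / 36 / (x ^ 2 + 2001 / 2000 * t ^ 2)) by field; lra.
apply: Rmult_le_compat_l; first by apply: Rdiv_le_0_compat; nra.
apply: (proj1 (Rle_div_r _ _ _ d0)).
have -> : 117 / 100 * / t ^ 2 * (x ^ 2 + 2001 / 2000 * t ^ 2) =
  117 / 100 * (x ^ 2 + 2001 / 2000 * t ^ 2) / t ^ 2 by field; lra.
by apply/Rle_div_l; nra.
Qed.

(** The exponent grows with x, so its value at x = 2/5 t decides; it is about 0.1876 / t. *)
Lemma damp_le_shoulder N t x : 0 < t <= 1 / 60 -> 2 / 5 * t <= x <= t -> tail_small N t ->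
  damp N t x <= exp (2 / 1000) * exp (- (187 / 1000 / t)).
Proof.
move=> t01 xt small; apply: Rle_trans (damp_le_near N t x t01 (ltac:(lra)) small) _.
rewrite -exp_plus; apply: exp_le_compat.
suff : 187 / 1000 / t <= 49 / 36 / t * (x ^ 2 / (x ^ 2 + 2001 / 2000 * t ^ 2)) by lra.
have d0 : 0 < x ^ 2 + 2001 / 2000 * t ^ 2 by nra.
have -> : 187 / 1000 / t = / t * (187 / 1000) by field; lra.
have -> : 49 / 36 / t * (x ^ 2 / (x ^ 2 + 2001 / 2000 * t ^ 2)) =
  / t * (49 / 36 * x ^ 2 / (x ^ 2 + 2001 / 2000 * t ^ 2)) by field; lra.
apply: Rmult_le_compat_l; first by apply/Rlt_le/Rinv_0_lt_compat; lra.
by apply: (proj1 (Rle_div_r _ _ _ d0)); nra.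
Qed.

(** Since cos decreases on [0, pi], the worst point is b t, and one kernel term suffices. The last
    condition says q b^2 >= 1 up to the quartic corrections of cosh and cos. *)
Lemma damp_le_far N t x b q : 0 < t <= 1 / 60 -> 1 <= b <= 4 -> b * t <= x <= PI ->
    0 < q -> tail_small N t -> 1001 / 1000 <= q * b ^ 2 * (999 / 1000) ->
  damp N t x <= exp (2 / 1000) * exp (- (/ (1 + q) / t)).
Proof.
move=> t01 b14 xb q0 small qb.
have pi3 : 3 < PI by have := PI2_3_2; lra.
apply: Rle_trans (damp_le_mid N t x q (proj1 t01) (ltac:(lra)) small _) _; last first.
  rewrite -exp_plus; apply: exp_le_compat.
  suff -> : / (1 + q) / t = 1 / t / (1 + q) by lra.
  by field; lra.
apply: Rle_trans (_ : q * (2 * (1 - cos (b * t))) <= _); last first.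
  apply: Rmult_le_compat_l; first lra.
  have : cos x <= cos (b * t) by apply: cos_decr_1; nra.
  by lra.
apply: Rle_trans (cosh2_le_quartic t (ltac:(lra))) _.
have bt : 0 <= b * t <= 1 / 15 by nra.
have c1 := cosB_ge_quartic (b * t) (proj1 bt).
have c2 : (b * t) ^ 2 * (999 / 1000) <= 2 * (1 - cos (b * t)).
  have : (b * t) ^ 2 <= 1 / 225 by nra.
  by have := pow2_ge_0 (b * t); nra.
apply: Rle_trans (Rmult_le_compat_l _ _ _ (Rlt_le _ _ q0) c2).
have -> : q * ((b * t) ^ 2 * (999 / 1000)) = t ^ 2 * (q * b ^ 2 * (999 / 1000)) by ring.
by apply: Rmult_le_compat_l; nra.
Qed.

Lemma exp_ge_quad x : 0 <= x -> 1 + x + x ^ 2 / 2 <= exp x.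
Proof.
move=> x0; suff : exp 0 - (1 + 0 + 0 ^ 2 / 2) <= exp x - (1 + x + x ^ 2 / 2).
  by rewrite exp_0; lra.
apply: (is_derive_ge0_le (fun x => exp x - (1 + x + x ^ 2 / 2)) (fun x => exp x - (1 + x))) => //.
  by move=> y _; auto_derive => //; field.
by move=> y _; have := exp_ineq1_le y; lra.
Qed.

Lemma exp_nat_mul x n : exp (INR n * x) = exp x ^ n.
Proof.
elim: n => [|n IHn]; first by rewrite /= Rmult_0_l exp_0.
by rewrite S_INR -tech_pow_Rmult -IHn -exp_plus; congr exp; ring.
Qed.

(* With z = t0/t: e^(-(c/t0)(z-1)) <= z^(-c/t0), since e^(z-1) >= z. *)
Lemma exp_decay c t t0 k : 0 < t <= t0 -> 0 < c -> INR k <= c / t0 ->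
  exp (- (c / t)) <= exp (- (c / t0)) * (t / t0) ^ k.
Proof.
move=> tt0 c0 kc; pose z := t0 / t.
have z1 : 1 <= z by apply: (proj1 (Rle_div_r _ _ _ (proj1 tt0))); lra.
have zE : (t / t0) ^ k = / z ^ k by rewrite -pow_inv /z; congr pow; field; lra.
have zk : 0 < z ^ k by apply: pow_lt; lra.
rewrite zE.
have -> : - (c / t) = - (c / t0) + - (c / t0 * (z - 1)) by rewrite /z; field; lra.
rewrite exp_plus; apply: Rmult_le_compat_l; first exact/Rlt_le/exp_pos.
rewrite exp_Ropp; apply: Rinv_le_contravar => //.
apply: Rle_trans (_ : exp (z - 1) ^ k <= _).
  by apply: pow_incr; have := exp_ineq1_le (z - 1); lra.
rewrite -exp_nat_mul; apply: exp_le_compat; apply: Rmult_le_compat_r; lra.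
Qed.

(** * Bounds on the cumulants *)

(** One integration; used alternately with its sinh twin, it climbs the Taylor polynomials from e^y
    + e^-y >= 2. *)
Lemma cosh2_ge_step (p p' : R -> R) : (forall y, is_derive p y (p' y)) -> p 0 = 2 ->
    (forall y, 0 <= y -> p' y <= exp y - exp (- y)) ->
  forall y, 0 <= y -> p y <= exp y + exp (- y).
Proof.
move=> dp p0 le_p y y0.
suff : exp 0 + exp (- 0) - p 0 <= exp y + exp (- y) - p y by rewrite Ropp_0 exp_0 p0; lra.
apply: (is_derive_ge0_le (fun y => exp y + exp (- y) - p y) (fun y => exp y - exp (- y) - p' y)) => //.
  move=> z _; apply: (is_derive_minus (fun y => exp y + exp (- y)) p) => //.
  by auto_derive => //; ring.
by move=> z [z0 _]; have := le_p z z0; lra.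
Qed.

Lemma sinh2_ge_step (p p' : R -> R) : (forall y, is_derive p y (p' y)) -> p 0 = 0 ->
    (forall y, 0 <= y -> p' y <= exp y + exp (- y)) ->
  forall y, 0 <= y -> p y <= exp y - exp (- y).
Proof.
move=> dp p0 le_p y y0.
suff : exp 0 - exp (- 0) - p 0 <= exp y - exp (- y) - p y by rewrite Ropp_0 exp_0 p0; lra.
apply: (is_derive_ge0_le (fun y => exp y - exp (- y) - p y) (fun y => exp y + exp (- y) - p' y)) => //.
  move=> z _; apply: (is_derive_minus (fun y => exp y - exp (- y)) p) => //.
  by auto_derive => //; ring.
by move=> z [z0 _]; have := le_p z z0; lra.
Qed.

Lemma cosh2_ge_sextic u : 0 <= u ->
  u ^ 2 * (1 + u ^ 2 / 12 + u ^ 4 / 360) <= exp u + exp (- u) - 2.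
Proof.
move=> u0; suff : 2 + u ^ 2 + u ^ 4 / 12 + u ^ 6 / 360 <= exp u + exp (- u) by nra.
apply: (cosh2_ge_step (fun u => 2 + u ^ 2 + u ^ 4 / 12 + u ^ 6 / 360)
  (fun u => 2 * u + u ^ 3 / 3 + u ^ 5 / 60)) u u0 => [y||]; [by auto_derive => //; field | field |].
apply: (sinh2_ge_step (fun u => 2 * u + u ^ 3 / 3 + u ^ 5 / 60)
  (fun u => 2 + u ^ 2 + u ^ 4 / 12)) => [y||]; [by auto_derive => //; field | field |].
apply: (cosh2_ge_step (fun u => 2 + u ^ 2 + u ^ 4 / 12)
  (fun u => 2 * u + u ^ 3 / 3)) => [y||]; [by auto_derive => //; field | field |].
apply: (sinh2_ge_step (fun u => 2 * u + u ^ 3 / 3)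
  (fun u => 2 + u ^ 2)) => [y||]; [by auto_derive => //; field | field |].
apply: (cosh2_ge_step (fun u => 2 + u ^ 2)
  (fun u => 2 * u)) => [y||]; [by auto_derive => //; field | field |].
apply: (sinh2_ge_step (fun u => 2 * u) (fun u => 2)) => [y||y _];
  [by auto_derive => //; field | ring |].
have := exp_pos y => e0; rewrite exp_Ropp.
have : exp y * / exp y = 1 by apply: Rinv_r; lra.
have := Rmult_le_pos _ _ (pow2_ge_0 (exp y - 1)) (Rlt_le _ _ (Rinv_0_lt_compat _ e0)).
move: (exp y) (/ exp y) => a b; have -> : (a - 1) ^ 2 * b = a * (a * b) - 2 * (a * b) + b by ring.
by move=> + ab; rewrite ab; lra.
Qed.

Lemma psum_pow0 x n : 0 <= x < 1 -> psum (fun k => x ^ k) n = x / (1 - x) - x ^ n * (x / (1 - x)).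
Proof.
move=> x01; elim: n => [|n IHn]; first by rewrite /=; ring.
have -> : psum (fun k => x ^ k) (S n) = psum (fun k => x ^ k) n + x ^ S n by [].
by rewrite IHn -tech_pow_Rmult; field; lra.
Qed.

Lemma psum_pow1 x n : 0 <= x < 1 -> psum (fun k => INR k * x ^ k) n =
  x / (1 - x) ^ 2 - x ^ n * (INR n * (x / (1 - x)) + x / (1 - x) ^ 2).
Proof.
move=> x01; elim: n => [|n IHn]; first by rewrite /=; ring.
have -> : psum (fun k => INR k * x ^ k) (S n) =
  psum (fun k => INR k * x ^ k) n + INR (S n) * x ^ S n by [].
by rewrite IHn S_INR -(tech_pow_Rmult x n); field; lra.
Qed.

Lemma psum_pow2 x n : 0 <= x < 1 -> psum (fun k => INR k ^ 2 * x ^ k) n =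
  x * (1 + x) / (1 - x) ^ 3 -
  x ^ n * (INR n ^ 2 * (x / (1 - x)) + 2 * INR n * (x / (1 - x) ^ 2) + x * (1 + x) / (1 - x) ^ 3).
Proof.
move=> x01; elim: n => [|n IHn]; first by rewrite /=; ring.
have -> : psum (fun k => INR k ^ 2 * x ^ k) (S n) =
  psum (fun k => INR k ^ 2 * x ^ k) n + INR (S n) ^ 2 * x ^ S n by [].
by rewrite IHn S_INR -(tech_pow_Rmult x n); field; lra.
Qed.

Lemma psum_pow3 x n : 0 <= x < 1 -> psum (fun k => INR k ^ 3 * x ^ k) n =
  x * (1 + 4 * x + x ^ 2) / (1 - x) ^ 4 -
  x ^ n * (INR n ^ 3 * (x / (1 - x)) + 3 * INR n ^ 2 * (x / (1 - x) ^ 2) +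
           3 * INR n * (x * (1 + x) / (1 - x) ^ 3) + x * (1 + 4 * x + x ^ 2) / (1 - x) ^ 4).
Proof.
move=> x01; elim: n => [|n IHn]; first by rewrite /=; ring.
have -> : psum (fun k => INR k ^ 3 * x ^ k) (S n) =
  psum (fun k => INR k ^ 3 * x ^ k) n + INR (S n) ^ 3 * x ^ S n by [].
by rewrite IHn S_INR -(tech_pow_Rmult x n); field; lra.
Qed.

Lemma polylog_ge0 x : 0 <= x < 1 ->
  [/\ 0 <= x / (1 - x), 0 <= x / (1 - x) ^ 2, 0 <= x * (1 + x) / (1 - x) ^ 3 &
      0 <= x * (1 + 4 * x + x ^ 2) / (1 - x) ^ 4].
Proof.
move=> x01; have p i : 0 < (1 - x) ^ i by apply: pow_lt; lra.
split; apply: Rdiv_le_0_compat => //; try lra; first by nra.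
by apply: Rmult_le_pos; nra.
Qed.

Lemma zeta2_psum M : psum (fun m => / INR m ^ 2) M <= 5 / 3.
Proof.
case: M => [|M]; first by rewrite /=; lra.
(* Midpoint telescoping: 1/(x+1)^2 <= 1/(x+1/2) - 1/(x+3/2). Equality for a single term fixes 5/3 =
   1 + 2/3. *)
suff : psum (fun m => / INR m ^ 2) (S M) <= 5 / 3 - / (INR (S M) + 1 / 2).
  have := pos_INR (S M) => p.
  have q : 0 < / (INR (S M) + 1 / 2) by apply: Rinv_0_lt_compat; lra.
  by move=> h; apply: Rle_trans h _; lra.
elim: M => [|M IHM]; first by rewrite /=; lra.
have -> : psum (fun m => / INR m ^ 2) (S (S M)) =
  psum (fun m => / INR m ^ 2) (S M) + / INR (S (S M)) ^ 2 by [].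
move: IHM; set s := psum _ _ => IHM; rewrite (S_INR (S M)); have : 1 <= INR (S M) by have := pos_INR M; rewrite S_INR; lra.
move: (INR (S M)) IHM => x IHM x1.
have : / (x + 1) ^ 2 <= / (x + 1 / 2) - / (x + 1 + 1 / 2).
  have -> : / (x + 1 / 2) - / (x + 1 + 1 / 2) = / ((x + 1 / 2) * (x + 1 + 1 / 2)).
    by field; lra.
  by apply: Rinv_le_contravar; nra.
by clearbody s; lra.
Qed.

(** Stands in for the limit as M grows: the remainders below are all kept in the form K / (M +
    1). *)
Lemma le_of_inv_bound a b K : (forall M, a <= b + K / INR (S M)) -> a <= b.
Proof.
move=> le_ab; apply: Rnot_lt_le => ba.
have [n nK] := nfloor_ex (Rabs K / (a - b)) (ltac:(apply: Rdiv_le_0_compat; [exact: Rabs_pos | lra])).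
have := le_ab n; have : K / INR (S n) < a - b; last lra.
apply/Rlt_div_l; first by have := pos_INR n; rewrite S_INR; lra.
have : Rabs K < INR (S n) * (a - b) by rewrite S_INR; apply/Rlt_div_l; lra.
by have := Rle_abs K; lra.
Qed.

Lemma pow_exp_decay x : 0 < x < 1 ->
  exists K, 0 <= K /\ forall M, x ^ S M * INR (S M) ^ 3 <= K.
Proof.
move=> x01; have y0 : 0 < - ln x by have := ln_increasing x 1 (proj1 x01) (proj2 x01); rewrite ln_1; lra.
(* From e^u >= u at u = - n ln x / 3, cubed. A cube is needed for a remainder quadratic in n that
   must still be at most K / n. *)
exists (27 / (- ln x) ^ 3); split.
  by apply: Rdiv_le_0_compat; [lra | apply: pow_lt].
move=> M; set n := S M.
have n0 : 0 < INR n by apply: lt_0_INR; lia.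
have xE : x ^ n = / exp (INR n * (- ln x) / 3) ^ 3.
  rewrite -exp_nat_mul -exp_Ropp -{1}(exp_ln x) -?exp_nat_mul; last lra.
  by congr exp; rewrite /=; field.
have e1 : (INR n * (- ln x) / 3) ^ 3 <= exp (INR n * (- ln x) / 3) ^ 3.
  apply: pow_incr; split; first by nra.
  by have := exp_ineq1_le (INR n * (- ln x) / 3); lra.
have ny : 0 < INR n * - ln x by apply: Rmult_lt_0_compat.
have p0 : 0 < (INR n * (- ln x) / 3) ^ 3 by apply: pow_lt; lra.
rewrite xE; apply: Rle_trans (Rmult_le_compat_r _ _ _ _ (Rinv_le_contravar _ _ p0 e1)) _.
  by apply: pow_le; lra.
by right; field; lra.
Qed.

(* If F(x) = sum_m m^j x^m then exchanging the sums over k and m leaves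
   sum_m m^j C / (m t)^(j+2) = C zeta(2) / t^(j+2), and zeta(2) <= 5/3. *)
Lemma double_sum_le (j : nat) (F : R -> R) (C t : R) (N : nat) : 0 < t -> 0 <= C ->
    (forall x, 0 < x < 1 -> exists K, forall M,
       F x <= psum (fun m => INR m ^ j * x ^ m) (S M) + K / INR (S M)) ->
    (forall u, 0 < u -> psum (fun k => INR k ^ S j * exp (- u) ^ k) N <= C / u ^ (S (S j))) ->
  psum (fun k => INR k ^ S j * F (rr t k)) N <= C * (5 / 3) / t ^ S (S j).
Proof.
move=> t0 C0 FK SC.
have [K HK] : exists K, forall M, psum (fun k => INR k ^ S j * F (rr t k)) N <=
    psum (fun k => INR k ^ S j * psum (fun m => INR m ^ j * rr t k ^ m) (S M)) N + K / INR (S M).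
  clear SC; elim: N => [|N [K IHN]]; first by exists 0 => M; rewrite /=; lra.
  have [K1 HK1] := FK (rr t (S N)) (rr_bound t N t0).
  exists (K + INR (S N) ^ S j * K1) => M.
  have := IHN M; have := HK1 M; rewrite -![psum _ (S N)]/(psum _ N + _).
  have : 0 <= INR (S N) ^ S j by apply: pow_le; apply: pos_INR.
  move: (INR (S N) ^ S j) => c c0 h1 h2.
  have := Rmult_le_compat_l _ _ _ c0 h1.
  by rewrite /Rdiv; lra.
apply: (le_of_inv_bound _ _ K) => M; apply: Rle_trans (HK M) _.
apply: Rplus_le_compat_r.
have -> : psum (fun k => INR k ^ S j * psum (fun m => INR m ^ j * rr t k ^ m) (S M)) N =
    psum (fun m => INR m ^ j * psum (fun k => INR k ^ S j * exp (- (INR m * t)) ^ k) N) (S M).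
  transitivity (psum (fun k => psum (fun m => INR k ^ S j * (INR m ^ j * rr t k ^ m)) (S M)) N).
    by apply: psum_ext => k; rewrite psum_scal.
  rewrite psum_swap; apply: psum_ext => m; rewrite -psum_scal; apply: psum_ext => k.
  rewrite rr_pow /rr -exp_nat_mul.
  have -> : - (INR (S k) * (INR (S m) * t)) = INR (S k) * - (INR (S m) * t) by ring.
  by ring.
apply: Rle_trans (_ : psum (fun m => C / t ^ S (S j) * / INR m ^ 2) (S M) <= _).
  apply: psum_le => m; have m0 : 0 < INR (S m) by apply: lt_0_INR; lia.
  apply: Rle_trans (Rmult_le_compat_l _ _ _ (pow_le _ j (Rlt_le _ _ m0)) (SC _ (Rmult_lt_0_compat _ _ m0 t0))) _.
  right; rewrite Rpow_mult_distr -!tech_pow_Rmult; field.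
  by repeat split; try apply: pow_nonzero; lra.
rewrite psum_scal; have := zeta2_psum (S M).
have : 0 <= C / t ^ S (S j) by apply: Rdiv_le_0_compat => //; apply: pow_lt.
rewrite /Rdiv; set a := / t ^ _ => h1 h2.
by have := Rmult_le_compat_l _ _ _ h1 h2; lra.
Qed.

(** With E = (1 - x)^2 / x = 2 cosh u - 2, the sums of k x^k and k^3 x^k are even in u and hence
    rational in E; the sum of k^2 x^k is odd, so only its square is. *)
Lemma polylog_exp u (x := exp (- u)) (E := exp u + exp (- u) - 2) : 0 < u ->
  [/\ 0 < E, x / (1 - x) ^ 2 = / E, (x * (1 + x) / (1 - x) ^ 3) ^ 2 = (E + 4) / E ^ 3 &
      x * (1 + 4 * x + x ^ 2) / (1 - x) ^ 4 = (E + 6) / E ^ 2].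
Proof.
move=> u0; have x01 : 0 < x < 1 := expN_lt1 u u0.
have EE : E = (1 - x) ^ 2 / x by rewrite /E -/x -(Ropp_involutive u) exp_Ropp -/x; field; lra.
rewrite EE; split.
- by apply: Rdiv_lt_0_compat; nra.
- by field; lra.
- by field; lra.
- by field; lra.
Qed.

Lemma remainder_le x (a b c : R) : 0 < x < 1 -> 0 <= a -> 0 <= b -> 0 <= c ->
  exists K, forall M, x ^ S M * (INR (S M) ^ 2 * a + 2 * INR (S M) * b + c) <= K / INR (S M).
Proof.
move=> x01 a0 b0 c0; have [K [K0 HK]] := pow_exp_decay x x01.
exists (K * (a + 2 * b + c)) => M; have := HK M.
have : 1 <= INR (S M) by rewrite S_INR; have := pos_INR M; lra.
have : 0 < x ^ S M by apply: pow_lt; lra.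
move: (INR (S M)) (x ^ S M) => n p p0 n1 le_K.
apply: (proj1 (Rle_div_r _ _ n (ltac:(lra)))).
apply: Rle_trans (_ : p * n ^ 3 * (a + 2 * b + c) <= _); last first.
  by apply: Rmult_le_compat_r => //; lra.
have -> : p * (n ^ 2 * a + 2 * n * b + c) * n = p * (n * (n ^ 2 * a + 2 * n * b + c)) by ring.
have -> : p * n ^ 3 * (a + 2 * b + c) = p * (n ^ 3 * (a + 2 * b + c)) by ring.
apply: Rmult_le_compat_l; first lra.
have n2 : n <= n ^ 2 by nra.
have n3 : n ^ 2 <= n ^ 3 by nra.
have := Rmult_le_compat_r b _ _ b0 n3; have := Rmult_le_compat_r c _ _ c0 n2.
by have := Rmult_le_compat_r c _ _ c0 n3; nra.
Qed.

Lemma polylog0_approx x : 0 < x < 1 -> exists K, forall M,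
  x / (1 - x) <= psum (fun m => INR m ^ 0 * x ^ m) (S M) + K / INR (S M).
Proof.
move=> x01; have [p0 p1 p2 _] := polylog_ge0 x (ltac:(lra)).
have [K HK] := remainder_le x _ _ _ x01 (Rle_refl 0) (Rle_refl 0) p0.
exists K => M; have := HK M.
rewrite (psum_ext _ (fun m => x ^ m)); last by move=> k; rewrite pow_O Rmult_1_l.
by rewrite psum_pow0; lra.
Qed.

Lemma polylog1_approx x : 0 < x < 1 -> exists K, forall M,
  x / (1 - x) ^ 2 <= psum (fun m => INR m ^ 1 * x ^ m) (S M) + K / INR (S M).
Proof.
move=> x01; have [p0 p1 p2 _] := polylog_ge0 x (ltac:(lra)).
have [K HK] := remainder_le x _ _ _ x01 (Rle_refl 0) (Rmult_le_pos _ _ (ltac:(lra) : 0 <= / 2) p0) p1.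
exists K => M; have := HK M.
rewrite (psum_ext _ (fun m => INR m * x ^ m)); last by move=> k; rewrite pow_1.
by rewrite psum_pow1; lra.
Qed.

Lemma polylog2_approx x : 0 < x < 1 -> exists K, forall M,
  x * (1 + x) / (1 - x) ^ 3 <= psum (fun m => INR m ^ 2 * x ^ m) (S M) + K / INR (S M).
Proof.
move=> x01; have [p0 p1 p2 _] := polylog_ge0 x (ltac:(lra)).
have [K HK] := remainder_le x _ _ _ x01 p0 p1 p2.
by exists K => M; have := HK M; rewrite psum_pow2; lra.
Qed.

Lemma mean_le N t : 0 < t -> mean N t <= 5 / 3 / t ^ 2.
Proof.
move=> t0.
have := double_sum_le 0 (fun x => x / (1 - x)) 1 t N t0 (ltac:(lra)) polylog0_approx.
rewrite Rmult_1_l => h; apply: Rle_trans (h _).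
  by right; apply: psum_ext => k; rewrite pow_1.
move=> u u0; have x01 := expN_lt1 u u0.
rewrite (psum_ext _ (fun k => INR k * exp (- u) ^ k)); last by move=> k; rewrite pow_1.
rewrite psum_pow1; last lra.
have [p0 p1 _ _] := polylog_ge0 (exp (- u)) (ltac:(lra)).
have xN : 0 < exp (- u) ^ N by apply: pow_lt; lra.
have iN := pos_INR N.
have : 0 <= exp (- u) ^ N * (INR N * (exp (- u) / (1 - exp (- u))) + exp (- u) / (1 - exp (- u)) ^ 2).
  by apply: Rmult_le_pos; nra.
have [E0 -> _ _] := polylog_exp u u0.
have := cosh2_ge_sextic u (ltac:(lra)).
move: (exp u + exp (- u) - 2) E0 => E E0 hE.
have : / E <= 1 / u ^ 2; last lra.
have u2 : 0 < u ^ 2 by nra.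
rewrite /Rdiv Rmult_1_l; apply: Rinv_le_contravar => //.
have : 0 <= u ^ 4 by apply: pow_le; lra.
have : 0 <= u ^ 6 by apply: pow_le; lra.
lra.
Qed.

Lemma var_le N t : 0 < t -> var N t <= 10 / 3 / t ^ 3.
Proof.
move=> t0.
have := double_sum_le 1 (fun x => x / (1 - x) ^ 2) 2 t N t0 (ltac:(lra)) polylog1_approx.
have -> : 2 * (5 / 3) = 10 / 3 by field.
apply=> u u0; have x01 := expN_lt1 u u0.
rewrite psum_pow2; last lra.
have [p0 p1 p2 _] := polylog_ge0 (exp (- u)) (ltac:(lra)).
have xN : 0 < exp (- u) ^ N by apply: pow_lt; lra.
have iN := pos_INR N.
set rem := exp (- u) ^ N * _.
have : 0 <= rem.
  apply: Rmult_le_pos; first lra.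
  by apply: Rplus_le_le_0_compat => //; apply: Rplus_le_le_0_compat; apply: Rmult_le_pos => //; nra.
suff : exp (- u) * (1 + exp (- u)) / (1 - exp (- u)) ^ 3 <= 2 / u ^ 3 by lra.
have [E0 _ e2 _] := polylog_exp u u0; have := cosh2_ge_sextic u (ltac:(lra)).
have u3 : 0 < u ^ 3 by apply: pow_lt.
move: p2 e2 E0; set S := _ / (1 - _) ^ 3; move: (exp u + exp (- u) - 2) => E p2 e2 E0 hE.
have d0 : 0 <= 2 / u ^ 3 by apply: Rdiv_le_0_compat; lra.
suff : S ^ 2 <= (2 / u ^ 3) ^ 2 by nra.
rewrite e2; have -> : (2 / u ^ 3) ^ 2 = 4 / u ^ 6 by field; lra.
apply: (proj1 (Rle_div_r _ _ (u ^ 6) (ltac:(apply: pow_lt; lra)))).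
have -> : (E + 4) / E ^ 3 * u ^ 6 = (E + 4) * u ^ 6 / E ^ 3 by field; lra.
apply/Rle_div_l; first by apply: pow_lt.
(* In terms of d the claim is u^2 (1 + d) + 4 <= 4 (1 + d)^3, and u^2 <= 12 d reduces it to d^3 >=
   0. *)
pose d := E / u ^ 2 - 1; have EE : E = u ^ 2 * (1 + d) by rewrite /d; field; lra.
have u2 : 0 < u ^ 2 by nra.
have du : u ^ 2 <= 12 * d.
  have : 0 <= u ^ 4 by apply: pow_le; lra.
  by rewrite EE in hE; nra.
have d1 : 0 <= d by lra.
have -> : (E + 4) * u ^ 6 = u ^ 6 * (u ^ 2 * (1 + d) + 4) by rewrite EE; ring.
have -> : 4 * E ^ 3 = u ^ 6 * (4 * (1 + d) ^ 3) by rewrite EE; ring.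
apply: Rmult_le_compat_l; first by apply: pow_le; lra.
have : 0 <= d ^ 3 by apply: pow_le.
by nra.
Qed.

(** The sum of k^3 e^(-ku) is 6 / u^4 + 1/120 + ..., slightly above 6 / u^4 for small u; 13/2 leaves
    room for this. *)
Lemma cum3_le N t : 0 < t -> cum3 N t <= 65 / 6 / t ^ 4.
Proof.
move=> t0.
have := double_sum_le 2 (fun x => x * (1 + x) / (1 - x) ^ 3) (13 / 2) t N t0 (ltac:(lra)) polylog2_approx.
have -> : 13 / 2 * (5 / 3) = 65 / 6 by field.
apply=> u u0; have x01 := expN_lt1 u u0.
rewrite psum_pow3; last lra.
have [p0 p1 p2 p3] := polylog_ge0 (exp (- u)) (ltac:(lra)).
have xN : 0 < exp (- u) ^ N by apply: pow_lt; lra.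
have iN := pos_INR N.
set rem := exp (- u) ^ N * _.
have : 0 <= rem.
  apply: Rmult_le_pos; first lra.
  apply: Rplus_le_le_0_compat => //; apply: Rplus_le_le_0_compat; last first.
    by apply: Rmult_le_pos => //; nra.
  by apply: Rplus_le_le_0_compat; apply: Rmult_le_pos => //; nra.
suff : exp (- u) * (1 + 4 * exp (- u) + exp (- u) ^ 2) / (1 - exp (- u)) ^ 4 <= 13 / 2 / u ^ 4 by lra.
have [E0 _ _ ->] := polylog_exp u u0; have := cosh2_ge_sextic u (ltac:(lra)).
move: (exp u + exp (- u) - 2) E0 => E E0 hE.
apply: (proj1 (Rle_div_r _ _ (u ^ 4) (ltac:(apply: pow_lt; lra)))).
have -> : (E + 6) / E ^ 2 * u ^ 4 = (E + 6) * u ^ 4 / E ^ 2 by field; lra.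
apply/Rle_div_l; first by apply: pow_lt.
pose d := E / u ^ 2 - 1; have EE : E = u ^ 2 * (1 + d) by rewrite /d; field; lra.
pose v := u ^ 2 / 12.
have u2 : 0 < u ^ 2 by nra.
have vd : v + 2 / 5 * v ^ 2 <= d.
  apply: (Rmult_le_reg_l (u ^ 2)) => //.
  have -> : u ^ 2 * d = E - u ^ 2 by rewrite EE; ring.
  by rewrite /v; lra.
have v0 : 0 < v by rewrite /v; lra.
have -> : (E + 6) * u ^ 4 = u ^ 4 * (12 * v * (1 + d) + 6) by rewrite EE /v; field.
have -> : 13 / 2 * E ^ 2 = u ^ 4 * (13 / 2 * (1 + d) ^ 2) by rewrite EE; ring.
apply: Rmult_le_compat_l; first by apply: pow_le; lra.
pose e := d - (v + 2 / 5 * v ^ 2); have e0 : 0 <= e by rewrite /e; lra.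
have -> : d = v + 2 / 5 * v ^ 2 + e by rewrite /e; ring.
have v3 : 0 <= v ^ 3 by apply: pow_le; lra.
have v4 : 0 <= v ^ 4 by apply: pow_le; lra.
have : 0 <= e * v by apply: Rmult_le_pos; lra.
have : 0 <= e * v ^ 2 by apply: Rmult_le_pos; nra.
have :=  pow2_ge_0 e; have := pow2_ge_0 (v - 1); nra.
Qed.

(** * The tail of the Fourier integrals *)

Lemma RInt_split (f : R -> R) a b c : (forall x, continuous f x) ->
  RInt f a c = RInt f a b + RInt f b c.
Proof.
by move=> cf; rewrite -(RInt_Chasles f a b c) //; apply: ex_RInt_cont.
Qed.

Lemma RInt_le_const (f : R -> R) a b c : a <= b -> (forall x, continuous f x) ->
  (forall x, a <= x <= b -> f x <= c) -> RInt f a b <= c * (b - a).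
Proof.
move=> ab cf le_f; have -> : c * (b - a) = RInt (fun _ => c) a b.
  by rewrite RInt_const /scal /= /mult /=; ring.
apply: RInt_le => //; [exact: ex_RInt_cont | exact: ex_RInt_const |].
by move=> x ax; apply: le_f; lra.
Qed.

Lemma RInt_ge_const (f : R -> R) a b c : a <= b -> (forall x, continuous f x) ->
  (forall x, a <= x <= b -> c <= f x) -> c * (b - a) <= RInt f a b.
Proof.
move=> ab cf le_f; have -> : c * (b - a) = RInt (fun _ => c) a b.
  by rewrite RInt_const /scal /= /mult /=; ring.
apply: RInt_le => //; [exact: ex_RInt_const | exact: ex_RInt_cont |].
by move=> x ax; apply: le_f; lra.
Qed.

(** The cube makes the primitive elementary; its value at the upper end has the favourable sign and
    is dropped. *)
Lemma RInt_cubic_gauss s w x y : 0 < s -> 0 < w -> x <= y ->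
  RInt (fun z => z ^ 3 * exp (- (w * z ^ 2 / s))) x y <=
  (s * x ^ 2 / (2 * w) + s ^ 2 / (2 * w ^ 2)) * exp (- (w * x ^ 2 / s)).
Proof.
move=> s0 w0 xy.
pose G z := - ((s * z ^ 2 / (2 * w) + s ^ 2 / (2 * w ^ 2)) * exp (- (w * z ^ 2 / s))).
have : is_RInt (fun z => z ^ 3 * exp (- (w * z ^ 2 / s))) x y (minus (G y) (G x)).
  apply: (is_RInt_derive G) => z _.
    rewrite /G; auto_derive => //.
    have -> : w * (z * (z * 1)) * / s = w * z ^ 2 / s by rewrite /= /Rdiv.
    by field; lra.
  by apply: ex_derive_continuous; auto_derive.
move/is_RInt_unique => ->.
have -> : minus (G y) (G x) = G y - G x by [].
rewrite /G.
have : 0 <= (s * y ^ 2 / (2 * w) + s ^ 2 / (2 * w ^ 2)) * exp (- (w * y ^ 2 / s)).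
  apply: Rmult_le_pos; last exact/Rlt_le/exp_pos.
  have := pow2_ge_0 y => y2.
  by apply: Rplus_le_le_0_compat; apply: Rdiv_le_0_compat; nra.
lra.
Qed.

Lemma exp_small_le x : 0 <= x < 1 -> exp x <= 1 / (1 - x).
Proof.
move=> x01; have := exp_ineq1_le (- x); rewrite exp_Ropp => h.
apply: (proj1 (Rle_div_r _ _ (1 - x) (ltac:(lra)))).
have p := exp_pos x; have := Rmult_le_compat_l (exp x) _ _ (Rlt_le _ _ p) h.
by rewrite Rinv_r; lra.
Qed.

Lemma exp1_ge : 271 / 100 <= exp 1.
Proof.
have -> : 1 = INR 8 * (1 / 8) by rewrite /=; field.
rewrite exp_nat_mul; apply: Rle_trans (_ : (1 + 1 / 8 + (1 / 8) ^ 2 / 2) ^ 8 <= _).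
  by rewrite /=; lra.
by apply: pow_incr; split; [lra | apply: exp_ge_quad; lra].
Qed.

Lemma expN_le_pow x y n : 0 <= y -> x = INR n + y ->
  exp (- x) <= / ((271 / 100) ^ n * (1 + y + y ^ 2 / 2)).
Proof.
move=> y0 ->; rewrite exp_Ropp exp_plus -(Rmult_1_r (INR n)) exp_nat_mul.
have e1 := exp1_ge; have e2 := exp_ge_quad y y0.
have p1 : 0 < (271 / 100) ^ n by apply: pow_lt; lra.
apply: Rinv_le_contravar; first by apply: Rmult_lt_0_compat => //; nra.
apply: Rmult_le_compat => //; [lra | nra |].
by apply: pow_incr; lra.
Qed.

Lemma expN_le_half x n : INR n <= x -> exp (- x) <= / 2 ^ n.
Proof.
move=> nx; rewrite exp_Ropp; have p : 0 < 2 ^ n by apply: pow_lt; lra.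
apply: Rinv_le_contravar => //; apply: Rle_trans (_ : exp (INR n * 1) <= _).
  by rewrite exp_nat_mul; apply: pow_incr; have := exp_ineq1_le 1; lra.
by apply: exp_le_compat; lra.
Qed.

(* Up to powers of t, [tailf] dominates all the integrands below outside the core |x| <= 9/5 t^(3/2). *)
Definition tailf (N : nat) (t x : R) : R := damp N t x * (x ^ 2 * (2 * t + x)).

Lemma continuous_tailf N t x : 0 < t -> continuous (tailf N t) x.
Proof.
move=> t0; apply: (continuous_mult (damp N t)); first exact: continuous_damp.
by apply: ex_derive_continuous; auto_derive.
Qed.

Lemma tailf_le N t x c d : 0 < t -> 0 <= x -> damp N t x <= c -> x ^ 2 * (2 * t + x) <= d ->
  tailf N t x <= c * d.
Proof.
move=> t0 x0 c1 d1; apply: Rmult_le_compat => //; first exact/Rlt_le/damp_gt0.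
by apply: Rmult_le_pos; nra.
Qed.

(** On this range 2 t + x <= 12/5 t, and a factor x / X >= 1, with X the lower end, raises x^2 to
    the x^3 that can be integrated. *)
Lemma RInt_tailf_near N t h : 0 < t <= 1 / 60 -> tail_small N t -> 0 < h -> t = h ^ 2 ->
  RInt (tailf N t) (9 / 5 * h ^ 3) (2 / 5 * t) <= 56 / 1000 * h ^ 11.
Proof.
move=> t01 small h0 th; have h60 : h <= 1 / 7 by nra.
set X := 9 / 5 * h ^ 3; have h3 : 0 < h ^ 3 by apply: pow_lt.
have X0 : 0 < X by rewrite /X; lra.
have X1 : X <= 2 / 5 * t by rewrite /X th; nra.
pose K := 12 / 5 * t * (1 / (1 - 2 / 1000)) / X.
apply: Rle_trans (_ : RInt (fun z => K * (z ^ 3 * exp (- (117 / 100 * z ^ 2 / t ^ 3))) ) X (2 / 5 * t) <= _).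
  apply: RInt_le => //.
  - by apply: ex_RInt_cont => x; apply: continuous_tailf; lra.
  - by apply: ex_RInt_cont => x; apply: ex_derive_continuous; auto_derive.
  move=> x Xx; have := damp_le_gauss N t x t01 (ltac:(lra)) small.
  move=> /(tailf_le N t x _ (x ^ 2 * (12 / 5 * t)) (proj1 t01) (ltac:(lra))) => tl.
  apply: Rle_trans (tl _) _; first by apply: Rmult_le_compat_l; nra.
  have e0 := exp_pos (- (117 / 100 * x ^ 2 / t ^ 3)).
  have e1 := exp_small_le (2 / 1000) (ltac:(lra)).
  have -> : K * (x ^ 3 * exp (- (117 / 100 * x ^ 2 / t ^ 3))) =
    1 / (1 - 2 / 1000) * exp (- (117 / 100 * x ^ 2 / t ^ 3)) * (x ^ 2 * (12 / 5 * t)) * (x / X).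
    by rewrite /K; field; lra.
  apply: Rle_trans (_ : 1 / (1 - 2 / 1000) * exp (- (117 / 100 * x ^ 2 / t ^ 3)) * (x ^ 2 * (12 / 5 * t)) <= _).
    apply: Rmult_le_compat_r; first nra.
    by apply: Rmult_le_compat_r; lra.
  rewrite -[X in X <= _]Rmult_1_r; apply: Rmult_le_compat_l.
    by apply: Rmult_le_pos; nra.
  by apply: (proj1 (Rle_div_r _ _ X X0)); lra.
have -> : RInt (fun z => K * (z ^ 3 * exp (- (117 / 100 * z ^ 2 / t ^ 3)))) X (2 / 5 * t) =
  K * RInt (fun z => z ^ 3 * exp (- (117 / 100 * z ^ 2 / t ^ 3))) X (2 / 5 * t).
  apply: (RInt_scal (fun z => z ^ 3 * exp (- (117 / 100 * z ^ 2 / t ^ 3)))).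
  by apply: ex_RInt_cont => x; apply: ex_derive_continuous; auto_derive.
have t3 : 0 < t ^ 3 by apply: pow_lt; lra.
have K0 : 0 <= K by apply: Rdiv_le_0_compat; lra.
apply: Rle_trans (Rmult_le_compat_l _ _ _ K0 (RInt_cubic_gauss (t ^ 3) (117 / 100) X _ t3 (ltac:(lra)) X1)) _.
(* At the cut-off the Gaussian exponent no longer depends on t. *)
have -> : 117 / 100 * X ^ 2 / t ^ 3 = INR 3 + 7908 / 10000 by rewrite /X th /=; field; lra.
have eX := expN_le_pow _ (7908 / 10000) 3 (ltac:(lra)) (erefl (INR 3 + 7908 / 10000)).
have c0 : 0 <= K * (t ^ 3 * X ^ 2 / (2 * (117 / 100)) + (t ^ 3) ^ 2 / (2 * (117 / 100) ^ 2)).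
  apply: Rmult_le_pos => //; apply: Rplus_le_le_0_compat; apply: Rdiv_le_0_compat; try lra.
    by apply: Rmult_le_pos; [lra | exact: pow2_ge_0].
  exact: pow2_ge_0.
rewrite -(Rmult_assoc K); apply: Rle_trans (Rmult_le_compat_l _ _ _ c0 eX) _.
have h11 : 0 < h ^ 11 by apply: pow_lt.
have -> : K * (t ^ 3 * X ^ 2 / (2 * (117 / 100)) + (t ^ 3) ^ 2 / (2 * (117 / 100) ^ 2)) =
  h ^ 11 * (12 / 5 * (1 / (1 - 2 / 1000)) / (9 / 5) * ((9 / 5) ^ 2 / (2 * (117 / 100)) + 1 / (2 * (117 / 100) ^ 2))).
  by rewrite /K /X th; field; lra.
by rewrite Rmult_assoc (Rmult_comm (56 / 1000)); apply: Rmult_le_compat_l; lra.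
Qed.

(** Of the four ranges only the Gaussian one, up to 2/5 t, has size h^11. The other three together
    give 0.098 t^6 = 0.098 h^12, and h <= 0.1293 brings this under the remaining 0.014 h^11. *)
Lemma RInt_tailf_le N t h : 0 < t <= 1 / 60 -> tail_small N t -> 0 < h -> t = h ^ 2 ->
  RInt (tailf N t) (9 / 5 * h ^ 3) PI <= 7 / 100 * h ^ 11.
Proof.
move=> t01 small h0 th; have h60 : h <= 1293 / 10000 by nra.
have pi4 := PI_4; have pi3 : 3 < PI by have := PI2_3_2; lra.
have ct x : continuous (tailf N t) x by apply: continuous_tailf; lra.
rewrite (RInt_split _ _ (2 / 5 * t)) // (RInt_split _ (2 / 5 * t) t) //.
rewrite (RInt_split _ t (4 * t)) //.
have i1 := RInt_tailf_near N t h t01 small h0 th.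
have e1 := exp_small_le (2 / 1000) (ltac:(lra)).
have e0 := exp_pos (2 / 1000).
have t6 : t ^ 6 = h ^ 11 * h by rewrite th; ring.
have t2 : 0 < t ^ 2 by nra.
have t3 : 0 < t ^ 3 by apply: pow_lt; lra.
have t4 : 0 < t ^ 4 by apply: pow_lt; lra.
have h11 : 0 < h ^ 11 by apply: pow_lt.
have t60 : 0 < t ^ 6 by apply: pow_lt; lra.
have i2 : RInt (tailf N t) (2 / 5 * t) t <= 93 / 1000 * t ^ 6.
  (* The weight gives t^3 and the length gives t, so the exponential has to supply t^2; 0.187 times
     60 is 11 + 0.22. *)
  have d := exp_decay (187 / 1000) t (1 / 60) 2 (ltac:(lra)) (ltac:(lra)) (ltac:(rewrite /=; lra)).
  have d1 := expN_le_pow (187 / 1000 / (1 / 60)) (22 / 100) 11 (ltac:(lra)) (ltac:(rewrite /=; lra)).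
  have d2 : exp (- (187 / 1000 / t)) <= 142 / 10000000 * (t / (1 / 60)) ^ 2.
    apply: Rle_trans d _; apply: Rmult_le_compat_r; first exact: pow2_ge_0.
    by apply: Rle_trans d1 _; rewrite /=; lra.
  have d3 : exp (2 / 1000) * exp (- (187 / 1000 / t)) <=
      1 / (1 - 2 / 1000) * (142 / 10000000 * (t / (1 / 60)) ^ 2).
    by apply: Rmult_le_compat => //; [lra | exact/Rlt_le/exp_pos].
  apply: Rle_trans (RInt_le_const _ _ _
    (1 / (1 - 2 / 1000) * (142 / 10000000 * (t / (1 / 60)) ^ 2) * (3 * t ^ 3)) _ _ _) _ => // [|x xt|].
  - by lra.
  - apply: tailf_le; [lra | lra | | ].
      by apply: Rle_trans (damp_le_shoulder N t x t01 (ltac:(lra)) small) d3.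
    by have : x ^ 2 <= t ^ 2 by [apply: pow_incr; lra]; nra.
  - have -> : 1 / (1 - 2 / 1000) * (142 / 10000000 * (t / (1 / 60)) ^ 2) * (3 * t ^ 3) * (t - 2 / 5 * t) =
      t ^ 6 * (1 / (1 - 2 / 1000) * (142 / 10000000 * 60 ^ 2) * (9 / 5)) by field.
    by rewrite Rmult_comm; apply: Rmult_le_compat_r; lra.
have far c n k b x : 0 < c -> INR k <= c / (1 / 60) -> INR n <= c / (1 / 60) -> b = / 2 ^ n ->
    damp N t x <= exp (2 / 1000) * exp (- (c / t)) ->
    damp N t x <= 2 * (b * (60 * t) ^ k).
  move=> c0 kc nc bE le_d; apply: Rle_trans le_d _.
  apply: Rmult_le_compat; [lra | exact/Rlt_le/exp_pos | lra |].
  have -> : 60 * t = t / (1 / 60) by field.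
  apply: Rle_trans (exp_decay c t (1 / 60) k (ltac:(lra)) c0 kc) _.
  apply: Rmult_le_compat_r; first by apply: pow_le; lra.
  by rewrite bE; apply: expN_le_half.
have i3 : RInt (tailf N t) t (4 * t) <= 4 / 1000 * t ^ 6.
  apply: Rle_trans (RInt_le_const _ _ _ (2 * (/ 2 ^ 29 * (60 * t) ^ 2) * (96 * t ^ 3)) _ _ _) _ => // [|x xt|].
  - by lra.
  - apply: tailf_le; [lra | lra | | ].
      apply: (far (49 / 100) 29%nat 2%nat (/ 2 ^ 29)) => //; try (rewrite /=; lra).
      apply: Rle_trans (damp_le_far N t x 1 (1021 / 1000) t01 _ _ _ small _) _; try lra.
      apply: Rmult_le_compat_l; first lra.
      apply: exp_le_compat; apply: Ropp_le_contravar; apply: Rmult_le_compat_r; last lra.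
      by apply/Rlt_le/Rinv_0_lt_compat; lra.
    by have : x ^ 2 <= (4 * t) ^ 2 by [apply: pow_incr; lra]; nra.
  - have -> : 2 * (/ 2 ^ 29 * (60 * t) ^ 2) * (96 * t ^ 3) * (4 * t - t) =
      t ^ 6 * (2 * (/ 2 ^ 29 * 60 ^ 2) * 288) by field.
    by rewrite Rmult_comm; apply: Rmult_le_compat_r; lra.
(* Neither the weight nor the length shrinks with t here: the exponential has to supply all of
   t^6. *)
have i4 : RInt (tailf N t) (4 * t) PI <= 1 / 1000 * t ^ 6.
  apply: Rle_trans (RInt_le_const _ _ _ (2 * (/ 2 ^ 56 * (60 * t) ^ 6) * 65) _ _ _) _ => // [|x xt|].
  - by lra.
  - apply: tailf_le; [lra | lra | | ].
      apply: (far (94 / 100) 56%nat 6%nat (/ 2 ^ 56)) => //; try (rewrite /=; lra).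
      apply: Rle_trans (damp_le_far N t x 4 (63 / 1000) t01 _ _ _ small _) _; try lra.
      apply: Rmult_le_compat_l; first lra.
      apply: exp_le_compat; apply: Ropp_le_contravar; apply: Rmult_le_compat_r; last lra.
      by apply/Rlt_le/Rinv_0_lt_compat; lra.
    by have : x ^ 2 <= 4 ^ 2 by [apply: pow_incr; lra]; nra.
  - apply: Rle_trans (_ : 2 * (/ 2 ^ 56 * (60 * t) ^ 6) * 65 * 4 <= _).
      apply: Rmult_le_compat_l; last lra.
      apply: Rmult_le_pos; last lra; apply: Rmult_le_pos; first lra.
      by apply: Rmult_le_pos; [apply/Rlt_le/Rinv_0_lt_compat; lra | apply: pow_le; lra].
    have -> : 2 * (/ 2 ^ 56 * (60 * t) ^ 6) * 65 * 4 = t ^ 6 * (2 * (/ 2 ^ 56 * 60 ^ 6) * 260) by field.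
    by rewrite Rmult_comm; apply: Rmult_le_compat_r; lra.
have : h ^ 11 * h <= h ^ 11 * (1293 / 10000) by apply: Rmult_le_compat_l; lra.
rewrite -t6; lra.
Qed.

(** * The second-order inequality for large n *)

Lemma sin_le_quintic x : 0 <= x -> sin x <= x - x ^ 3 / 6 + x ^ 5 / 120.
Proof.
move=> x0; suff : 0 - 0 ^ 3 / 6 + 0 ^ 5 / 120 - sin 0 <= x - x ^ 3 / 6 + x ^ 5 / 120 - sin x.
  by rewrite sin_0; lra.
apply: (is_derive_ge0_le (fun x => x - x ^ 3 / 6 + x ^ 5 / 120 - sin x)
  (fun x => 1 - x ^ 2 / 2 + x ^ 4 / 24 - cos x)) => // y [y0 _].
  by auto_derive => //; field.
by have := cosB_ge_quartic y y0; lra.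
Qed.

Lemma cos_ge_sextic x : 0 <= x -> 1 - x ^ 2 / 2 + x ^ 4 / 24 - x ^ 6 / 720 <= cos x.
Proof.
move=> x0.
suff : cos 0 - (1 - 0 ^ 2 / 2 + 0 ^ 4 / 24 - 0 ^ 6 / 720) <=
       cos x - (1 - x ^ 2 / 2 + x ^ 4 / 24 - x ^ 6 / 720) by rewrite cos_0; lra.
apply: (is_derive_ge0_le (fun x => cos x - (1 - x ^ 2 / 2 + x ^ 4 / 24 - x ^ 6 / 720))
  (fun x => x - x ^ 3 / 6 + x ^ 5 / 120 - sin x)) => // y [y0 _].
  by auto_derive => //; field.
by have := sin_le_quintic y y0; lra.
Qed.

(** 137/100, below pi/2, is the bound on the core phases given by [defect_core]; 19/100 is the
    sextic Taylor polynomial there, rounded down. *)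
Lemma cos_ge_19 y : 0 <= y <= 137 / 100 -> 19 / 100 <= cos y.
Proof.
move=> y01; have pi3 : 3 < PI by have := PI2_3_2; lra.
have : cos (137 / 100) <= cos y by apply: cos_decr_1; lra.
by have := cos_ge_sextic (137 / 100) (ltac:(lra)); lra.
Qed.

(** Common pattern of the lower bounds below: positivity in the core, a gain c on a window where the
    integrand peaks, and a loss g, always a multiple of [tailf], in the tail. *)
Lemma RInt_ge_window (f g : R -> R) p q x b c : 0 <= p <= q -> q <= x <= b ->
    (forall z, continuous f z) -> (forall z, continuous g z) ->
    (forall z, 0 <= z <= x -> 0 <= f z) -> (forall z, p <= z <= q -> c <= f z) ->
    (forall z, x <= z <= b -> - g z <= f z) ->
  c * (q - p) - RInt g x b <= RInt f 0 b.
Proof.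
move=> pq qx cf cg f0 fc fg.
rewrite (RInt_split f 0 p) // (RInt_split f p q) // (RInt_split f q x) //.
have i1 := RInt_ge_const f 0 p 0 (ltac:(lra)) cf (fun z h => f0 z (ltac:(lra))).
have i2 := RInt_ge_const f p q c (ltac:(lra)) cf fc.
have i3 := RInt_ge_const f q x 0 (ltac:(lra)) cf (fun z h => f0 z (ltac:(lra))).
suff : - RInt g x b <= RInt f x b by lra.
have -> : - RInt g x b = RInt (fun z => -1 * g z + 0 * g z) x b by rewrite RInt_lin //; ring.
apply: RInt_le; [lra | | exact: ex_RInt_cont | ].
  apply: ex_RInt_cont => z.
  by apply: (continuous_plus (fun z => -1 * g z) (fun z => 0 * g z));
    apply: continuous_mult => //; exact: continuous_const.
by move=> z zx; have := fg z (ltac:(lra)); lra.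
Qed.

Lemma RInt_tail_scal (g : R -> R) x b c : (forall z, continuous g z) ->
  RInt (fun z => c * g z) x b = c * RInt g x b.
Proof. by move=> cg; apply: (RInt_scal g); apply: ex_RInt_cont. Qed.

(** * Finite differences of the Fourier integrals *)

(** [e^(ix) - 1 = i (chord x) e^(ix/2)]: each difference contributes one factor [chord x] and shifts
    the phase by x/2. *)
Definition chord (x : R) : R := 2 * sin (x / 2).

Lemma chord_sqr x : chord x ^ 2 = 2 * (1 - cos x).
Proof.
have {2}-> : x = x / 2 + x / 2 by field.
rewrite cos_plus /chord; have := sin2_cos2 (x / 2); rewrite /Rsqr; nra.
Qed.

Lemma chord_bounds x : 0 <= x <= PI -> 0 <= chord x <= x.
Proof.
move=> x0; rewrite /chord; have := sin_le_id (x / 2) (ltac:(lra)).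
by have := sin_ge_0 (x / 2) (ltac:(lra)) (ltac:(lra)); lra.
Qed.

Lemma wave_diff1 N t m x (X := m * x - phase N t x) :
  wave N t m x - wave N t (m + 1) x = damp N t x * (chord x * sin (X + x / 2)).
Proof.
rewrite /wave -Rmult_minus_distr_l; congr (_ * _).
rewrite -(cos_neg (phase N t x - m * x)) -(cos_neg (phase N t x - (m + 1) * x)).
set A := X + x / 2.
have -> : - (phase N t x - m * x) = A - x / 2 by rewrite /A /X; field.
have -> : - (phase N t x - (m + 1) * x) = A + x / 2 by rewrite /A /X; field.
by rewrite cos_minus cos_plus /chord; ring.
Qed.

Lemma wave_diff2 N t m x (X := m * x - phase N t x) :
  2 * wave N t (m + 1) x - wave N t m x - wave N t (m + 2) x =
  damp N t x * (chord x ^ 2 * cos (X + x)).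
Proof.
rewrite chord_sqr /wave.
rewrite -(cos_neg (phase N t x - m * x)) -(cos_neg (phase N t x - (m + 1) * x))
  -(cos_neg (phase N t x - (m + 2) * x)).
set A := X + x.
have -> : - (phase N t x - m * x) = A - x by rewrite /A /X; field.
have -> : - (phase N t x - (m + 1) * x) = A by rewrite /A /X; field.
have -> : - (phase N t x - (m + 2) * x) = A + x by rewrite /A /X; field.
by rewrite cos_minus cos_plus; ring.
Qed.

Lemma wave_diff3 N t m x (X := m * x - phase N t x) :
  wave N t (m + 3) x - 3 * wave N t (m + 2) x + 3 * wave N t (m + 1) x - wave N t m x =
  damp N t x * (chord x ^ 3 * sin (X + 3 / 2 * x)).
Proof.
rewrite /wave /chord.
rewrite -(cos_neg (phase N t x - m * x)) -(cos_neg (phase N t x - (m + 1) * x))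
  -(cos_neg (phase N t x - (m + 2) * x)) -(cos_neg (phase N t x - (m + 3) * x)).
set Y := X + 3 / 2 * x; set y := x / 2.
have -> : - (phase N t x - m * x) = Y - (y + y + y) by rewrite /Y /X /y; field.
have -> : - (phase N t x - (m + 1) * x) = Y - y by rewrite /Y /X /y; field.
have -> : - (phase N t x - (m + 2) * x) = Y + y by rewrite /Y /X /y; field.
have -> : - (phase N t x - (m + 3) * x) = Y + (y + y + y) by rewrite /Y /X /y; field.
have s3 : sin (y + y + y) = 3 * sin y - 4 * sin y ^ 3.
  rewrite !sin_plus cos_plus; have := sin2_cos2 y; rewrite /Rsqr => sc.
  have -> : cos y * cos y = 1 - sin y * sin y by lra.
  have -> : (sin y * cos y + cos y * sin y) * cos y = 2 * sin y * (cos y * cos y) by ring.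
  have -> : cos y * cos y = 1 - sin y * sin y by lra.
  by ring.
by rewrite !cos_minus !cos_plus s3; ring.
Qed.

Lemma damp_ge_scaled N t h x : 0 < t -> 0 < h -> t = h ^ 2 -> 0 <= x ->
  exp (- (5 / 3 * x ^ 2 / h ^ 6)) <= damp N t x.
Proof.
move=> t0 h0 th x0; apply: Rle_trans (damp_ge_gauss N t x t0).
apply: exp_le_compat; apply: Ropp_le_contravar.
have -> : 5 / 3 * x ^ 2 / h ^ 6 = 10 / 3 / t ^ 3 * (x ^ 2 / 2) by rewrite th; field; lra.
have -> : var N t * x ^ 2 / 2 = var N t * (x ^ 2 / 2) by field.
by apply: Rmult_le_compat_r (var_le N t t0); have := pow2_ge_0 x; lra.
Qed.

(** At the scale h^3, where the Gaussian exponent is of order one, the cubic defect is of order x^3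
    / t^4, that is h. The constant is that of [cum3_le] divided by 6. *)
Lemma phase_scaled N t h x k : 0 < t -> 0 < h -> t = h ^ 2 -> 0 <= x <= k * h ^ 3 -> 0 <= k ->
  0 <= mean N t * x - phase N t x <= 65 / 36 * k ^ 3 * h.
Proof.
move=> t0 h0 th xk k0; have [lo up] := phase_defect_bounds N t x t0 (proj1 xk).
split => //; apply: Rle_trans up _.
have x3 : x ^ 3 <= (k * h ^ 3) ^ 3 by apply: pow_incr.
have c0 := cum3_le N t t0; have p3 : 0 <= x ^ 3 by apply: pow_le; lra.
apply: Rle_trans (_ : 65 / 6 / t ^ 4 * (x ^ 3) / 6 <= _).
  by rewrite /Rdiv; apply: Rmult_le_compat_r; [lra | apply: Rmult_le_compat_r].
have q0 : 0 < 65 / 6 / t ^ 4 by apply: Rdiv_lt_0_compat; [lra | apply: pow_lt].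
apply: Rle_trans (_ : 65 / 6 / t ^ 4 * ((k * h ^ 3) ^ 3) / 6 <= _).
  by rewrite /Rdiv; apply: Rmult_le_compat_r; [lra | apply: Rmult_le_compat_l => //; lra].
by right; rewrite th; field; lra.
Qed.

Lemma exp_le_chord x y b : 0 <= b <= 1 ->
  exp ((1 - b) * x + b * y) <= (1 - b) * exp x + b * exp y.
Proof.
move=> b01; set p := (1 - b) * x + b * y; have p0 := exp_pos p.
have tangent z : exp p * (1 + (z - p)) <= exp z.
  have -> : exp z = exp p * exp (z - p) by rewrite -exp_plus; congr exp; ring.
  by apply: Rmult_le_compat_l; [lra | exact: exp_ineq1_le].
have := Rmult_le_compat_l _ _ _ (proj1 b01) (tangent y).
have := Rmult_le_compat_l (1 - b) _ _ (ltac:(lra)) (tangent x).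
have -> : b * (exp p * (1 + (y - p))) =
  exp p - (1 - b) * (exp p * (1 + (x - p))) by rewrite /p; ring.
by lra.
Qed.

(* On an interval [z * exp (-5z/3)] is at least its smaller endpoint value,
   because [exp] lies below its chord. *)
Lemma window_ge z : 1 / 4 <= z <= 36 / 25 -> 1 / 8 <= z * exp (- (5 / 3 * z)).
Proof.
move=> z01; pose b := (z - 1 / 4) / (119 / 100).
have b01 : 0 <= b <= 1 by rewrite /b; split; lra.
have := exp_le_chord (5 / 12) (12 / 5) b b01.
have -> : (1 - b) * (5 / 12) + b * (12 / 5) = 5 / 3 * z by rewrite /b; field.
have c1 : exp (5 / 12) <= 16 / 10.
  have -> : 5 / 12 = INR 8 * (5 / 96) by rewrite /=; field.
  rewrite exp_nat_mul; apply: Rle_trans (_ : (1 / (1 - 5 / 96)) ^ 8 <= _); last lra.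
  by apply: pow_incr; split; [exact/Rlt_le/exp_pos | apply: exp_small_le; lra].
have c2 : exp (12 / 5) <= 23 / 2.
  have -> : 12 / 5 = INR 96 * (1 / 40) by rewrite /=; field.
  rewrite exp_nat_mul; apply: Rle_trans (_ : (1 / (1 - 1 / 40)) ^ 96 <= _); last lra.
  by apply: pow_incr; split; [exact/Rlt_le/exp_pos | apply: exp_small_le; lra].
have := Rmult_le_compat_l (1 - b) _ _ (ltac:(lra)) c1.
have := Rmult_le_compat_l b _ _ (proj1 b01) c2 => h1 h2 h3.
have zE : z = 1 / 4 + 119 / 100 * b by rewrite /b; field.
have e0 := exp_pos (5 / 3 * z).
rewrite exp_Ropp; apply: (proj1 (Rle_div_r _ _ _ e0)); lra.
Qed.

Definition defect (N : nat) (t x : R) : R := mean N t * x - phase N t x.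

(* Integrands of the finite differences m1, m2, m3 of the Fourier coefficients. *)
Definition term1 N t x := damp N t x * (chord x * sin (defect N t x + x / 2)).
Definition term2 N t x := damp N t x * (chord x ^ 2 * cos (defect N t x + x)).
Definition term3 N t x := damp N t x * (chord x ^ 3 * sin (defect N t x + 3 / 2 * x)).

(** This limits the cut-off: at 9/5 h^3 the defect is at most 65/36 (9/5)^3 h < 1.361, and 3/2 x
    adds less than 0.006. With 2 h^3 the bound would already exceed pi/2. *)
Lemma defect_core N t h x : 0 < t -> 0 < h <= 1292 / 10000 -> t = h ^ 2 -> 0 <= x <= 9 / 5 * h ^ 3 ->
  0 <= defect N t x /\ defect N t x + 3 / 2 * x <= 137 / 100.
Proof.
move=> t0 h0 th x0; have [lo up] := phase_scaled N t h x (9 / 5) t0 (proj1 h0) th x0 (ltac:(lra)).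
have h3 : h ^ 3 <= (1292 / 10000) ^ 3 by apply: pow_incr; lra.
by rewrite /defect; split => //; lra.
Qed.

(** 1 - e^(-2t) >= 2 t - 2 t^2, and 118/60 = 2 (1 - 1/60). *)
Lemma decay_factor t : 0 < t <= 1 / 60 -> 118 / 60 * t <= 1 - exp (- (2 * t)) <= 2 * t.
Proof.
move=> t01; split; last by have := exp_ineq1_le (- (2 * t)); lra.
have e0 := exp_pos (2 * t); rewrite exp_Ropp.
suff : / exp (2 * t) <= 1 - 118 / 60 * t by lra.
apply: Rle_trans (_ : / (1 + 2 * t + (2 * t) ^ 2 / 2) <= _).
  by apply: Rinv_le_contravar; [nra | apply: exp_ge_quad; lra].
apply: (Rmult_le_reg_l (1 + 2 * t + (2 * t) ^ 2 / 2)); first nra.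
rewrite Rinv_r; last nra.
by nra.
Qed.

(* Up to x = 9/5 t^(3/2) all phases stay below pi/2, so the integrands keep a sign. *)
Lemma core_angles N t h x : 0 < t -> 0 < h <= 1292 / 10000 -> t = h ^ 2 -> 0 <= x <= 9 / 5 * h ^ 3 ->
  [/\ 0 <= chord x <= x, 0 <= sin (defect N t x + x / 2), 0 <= sin (defect N t x + 3 / 2 * x) <= 1,
      19 / 100 <= cos (defect N t x + x) & 19 / 100 <= cos (defect N t x)].
Proof.
move=> t0 h0 th x0; have [d0 d1] := defect_core N t h x t0 h0 th x0.
have pi3 : 3 < PI by have := PI2_3_2; lra.
have h3 : h ^ 3 <= (1292 / 10000) ^ 3 by apply: pow_incr; lra.
split; first by apply: chord_bounds; lra.
- by apply: sin_ge_0; lra.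
- by split; [apply: sin_ge_0; lra | have := SIN_bound (defect N t x + 3 / 2 * x); lra].
- by apply: cos_ge_19; lra.
- by apply: cos_ge_19; lra.
Qed.

Lemma continuous_defect_comp N t (f : R -> R) c x : 0 < t -> (forall y, continuous f y) ->
  continuous (fun x => f (defect N t x + c * x)) x.
Proof.
move=> t0 cf; apply: (continuous_comp (fun x => defect N t x + c * x) f) => //.
have lin a : continuous (fun x : R => a * x) x.
  by apply: continuous_mult; [exact: continuous_const | exact: continuous_id].
apply: (continuous_plus (defect N t)) => //.
apply: (continuous_minus (fun x => mean N t * x) (phase N t)) => //.
exact: continuous_phase.
Qed.

Lemma continuous_term N t k (f : R -> R) c x : 0 < t -> (forall y, continuous f y) ->
  continuous (fun x => damp N t x * (chord x ^ k * f (defect N t x + c * x))) x.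
Proof.
move=> t0 cf; apply: (continuous_mult (damp N t)); first exact: continuous_damp.
apply: (continuous_mult (fun x => chord x ^ k)); last exact: continuous_defect_comp.
by apply: ex_derive_continuous; rewrite /chord; auto_derive.
Qed.

Lemma continuous_term1 N t x : 0 < t -> continuous (term1 N t) x.
Proof.
move=> t0; apply: (continuous_ext (fun x => damp N t x * (chord x ^ 1 * sin (defect N t x + / 2 * x)))).
  by move=> y; rewrite /term1 pow_1 /Rdiv (Rmult_comm y).
by apply: continuous_term => //; exact: continuous_sin.
Qed.

Lemma continuous_term2 N t x : 0 < t -> continuous (term2 N t) x.
Proof.
move=> t0; apply: (continuous_ext (fun x => damp N t x * (chord x ^ 2 * cos (defect N t x + 1 * x)))).
  by move=> y; rewrite /term2 Rmult_1_l.
by apply: continuous_term => //; exact: continuous_cos.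
Qed.

Lemma continuous_term3 N t x : 0 < t -> continuous (term3 N t) x.
Proof. by move=> t0; apply: continuous_term => //; exact: continuous_sin. Qed.

Lemma abs_term_le d a s m : 0 <= d -> 0 <= a <= m -> -1 <= s <= 1 -> - (d * m) <= d * (a * s) <= d * m.
Proof.
move=> d0 am s1; have h : - m <= a * s <= m by split; nra.
have := Rmult_le_compat_l d _ _ d0 (proj1 h); have := Rmult_le_compat_l d _ _ d0 (proj2 h); lra.
Qed.

Lemma wave0E N t x : wave N t (mean N t) x = damp N t x * (1 * cos (defect N t x)).
Proof.
rewrite /wave /defect Rmult_1_l -(cos_neg (phase N t x - _)); congr (_ * cos _); ring.
Qed.

(** * Bounds on the integrals *)

(** Up to 7/10 h^3 the Gaussian is at least e^(-49/60) > 0.43, and the defect is so small that its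
    cosine exceeds 0.996. The window gives 0.2996 h^3, of which the tail takes at most 0.011 h^3. *)
Lemma RInt_wave0_ge N t h : 0 < t <= 1 / 60 -> tail_small N t -> 0 < h -> t = h ^ 2 ->
  285 / 1000 * h ^ 3 <= RInt (wave N t (mean N t)) 0 PI.
Proof.
move=> t01 small h0 th; have h1 : h <= 1292 / 10000 by nra.
have h3 : 0 < h ^ 3 by apply: pow_lt.
have h3' : h ^ 3 <= (1292 / 10000) ^ 3 by apply: pow_incr; lra.
have pi3 : 3 < PI by have := PI2_3_2; lra.
set X0 := 9 / 5 * h ^ 3; have X00 : 0 < X0 by rewrite /X0; lra.
(* Beyond X0 the weight of [tailf] is at least 2 t X0^2, so k times [tailf] dominates [damp]. The
   next bounds drop one power of X0 for each [chord] in the integrand. *)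
pose k := / (2 * t * X0 ^ 2).
have d0 : 0 < 2 * t * X0 ^ 2 by apply: Rmult_lt_0_compat; nra.
have k0 : 0 < k by apply: Rinv_0_lt_compat.
have V := RInt_tailf_le N t h t01 small h0 th; rewrite -/X0 in V.
have ct x : continuous (tailf N t) x by apply: continuous_tailf; lra.
have := RInt_ge_window (wave N t (mean N t)) (fun z => k * tailf N t z) 0 (7 / 10 * h ^ 3) X0 PI (428 / 1000).
rewrite RInt_tail_scal // => W.
have kV : k * RInt (tailf N t) X0 PI <= 11 / 1000 * h ^ 3.
  apply: Rle_trans (Rmult_le_compat_l _ _ _ (Rlt_le _ _ k0) V) _.
  have -> : k * (7 / 100 * h ^ 11) = h ^ 3 * (7 / 100 / (2 * (9 / 5) ^ 2)).
    by rewrite /k /X0 th; field; lra.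
  by lra.
suff : 428 / 1000 * (7 / 10 * h ^ 3 - 0) - k * RInt (tailf N t) X0 PI <= RInt (wave N t (mean N t)) 0 PI by lra.
apply: W => [||z|z|z zX|z zX|z zX].
- by lra.
- by rewrite /X0; lra.
- by apply: continuous_wave; lra.
- by apply: continuous_mult => //; exact: continuous_const.
- rewrite wave0E; have [_ _ _ _ c0] := core_angles N t h z (ltac:(lra)) (ltac:(lra)) th zX.
  by apply: Rmult_le_pos; [apply/Rlt_le/damp_gt0; lra | lra].
- rewrite wave0E.
  have zh : 0 <= z <= 7 / 10 * h ^ 3 by lra.
  have [lo up] := phase_scaled N t h z (7 / 10) (proj1 t01) h0 th zh (ltac:(lra)).
  have d := damp_ge_scaled N t h z (proj1 t01) h0 th (proj1 zh).
  have e1 : 43 / 100 <= damp N t z.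
    apply: Rle_trans _ d; apply: Rle_trans (_ : exp (- (49 / 60)) <= _); last first.
      apply: exp_le_compat; apply: Ropp_le_contravar.
      have -> : 5 / 3 * z ^ 2 / h ^ 6 = 5 / 3 * (z / h ^ 3) ^ 2 by field; lra.
      have : 0 <= z / h ^ 3 <= 7 / 10.
        by split; [apply: Rdiv_le_0_compat; lra | apply/Rle_div_l; lra].
      by nra.
    have -> : - (49 / 60) = INR 16 * (- (49 / 960)) by rewrite /=; field.
    rewrite exp_nat_mul; apply: Rle_trans (_ : (1 - 49 / 960) ^ 16 <= _); first lra.
    by apply: pow_incr; split; [lra | exact: exp_ineq1_le].
  have c1 : 996 / 1000 <= cos (defect N t z).
    by have := cosB_le_sqr (defect N t z); rewrite /defect; nra.
  nra.
- rewrite wave0E.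
  have dp := damp_gt0 N t z (proj1 t01).
  have [lo _] := abs_term_le (damp N t z) 1 (cos (defect N t z)) 1 (ltac:(lra)) (ltac:(lra)) (COS_bound _).
  apply: Rle_trans lo; apply: Ropp_le_contravar.
  rewrite /tailf -Rmult_assoc (Rmult_comm k) Rmult_assoc; apply: Rmult_le_compat_l; first lra.
  rewrite Rmult_comm; apply: (proj1 (Rle_div_r _ _ _ d0)).
  have : X0 ^ 2 <= z ^ 2 by apply: pow_incr; lra.
  by nra.
Qed.

(** The window is degenerate: positivity in the core suffices, and the whole deficit comes from the
    tail. *)
Lemma RInt_term1_ge N t h : 0 < t <= 1 / 60 -> tail_small N t -> 0 < h -> t = h ^ 2 ->
  - (2 / 100 * h ^ 6) <= RInt (term1 N t) 0 PI.
Proof.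
move=> t01 small h0 th; have h1 : h <= 1292 / 10000 by nra.
have h3 : 0 < h ^ 3 by apply: pow_lt.
have h3' : h ^ 3 <= (1292 / 10000) ^ 3 by apply: pow_incr; lra.
have pi3 : 3 < PI by have := PI2_3_2; lra.
set X0 := 9 / 5 * h ^ 3; have X00 : 0 < X0 by rewrite /X0; lra.
have d0 : 0 < 2 * t * X0 by apply: Rmult_lt_0_compat; nra.
pose k := / (2 * t * X0); have k0 : 0 < k by apply: Rinv_0_lt_compat.
have V := RInt_tailf_le N t h t01 small h0 th; rewrite -/X0 in V.
have ct x : continuous (tailf N t) x by apply: continuous_tailf; lra.
have := RInt_ge_window (term1 N t) (fun z => k * tailf N t z) 0 0 X0 PI 0.
rewrite RInt_tail_scal // => W.
have kV : k * RInt (tailf N t) X0 PI <= 2 / 100 * h ^ 6.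
  apply: Rle_trans (Rmult_le_compat_l _ _ _ (Rlt_le _ _ k0) V) _.
  have -> : k * (7 / 100 * h ^ 11) = h ^ 6 * (7 / 100 / (2 * (9 / 5))).
    by rewrite /k /X0 th; field; lra.
  by have : 0 < h ^ 6 by [apply: pow_lt]; lra.
have pos z : 0 <= z <= X0 -> 0 <= term1 N t z.
  move=> zX; have [c0 s0 _ _ _] := core_angles N t h z (ltac:(lra)) (ltac:(lra)) th zX.
  by apply: Rmult_le_pos; [apply/Rlt_le/damp_gt0; lra | apply: Rmult_le_pos; lra].
suff : 0 * (0 - 0) - k * RInt (tailf N t) X0 PI <= RInt (term1 N t) 0 PI by lra.
apply: W => [||z|z|z zX|z zX|z zX].
- by lra.
- by rewrite /X0; lra.
- by apply: continuous_term1; lra.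
- by apply: continuous_mult => //; exact: continuous_const.
- exact: pos.
- by apply: pos; lra.
- have dp := damp_gt0 N t z (proj1 t01).
  have [lo _] := abs_term_le (damp N t z) _ _ z (ltac:(lra)) (chord_bounds z (ltac:(lra)))
    (SIN_bound (defect N t z + z / 2)).
  apply: Rle_trans lo; apply: Ropp_le_contravar.
  rewrite /tailf -Rmult_assoc (Rmult_comm k) Rmult_assoc; apply: Rmult_le_compat_l; first lra.
  rewrite Rmult_comm; apply: (proj1 (Rle_div_r _ _ _ d0)).
  have : X0 * z <= z ^ 2 by nra.
  by nra.
Qed.

(** With y = z / h^3 the weight y^2 e^(-5 y^2 / 3) peaks at y^2 = 3/5, inside the window. It is at
    least 1/8 there by [window_ge]; the remaining constants are the phase bounds for k = 6/5. *)
Lemma window_term N t h z : 0 < t -> 0 < h <= 1292 / 10000 -> t = h ^ 2 ->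
    1 / 2 * h ^ 3 <= z <= 6 / 5 * h ^ 3 ->
  [/\ 1249 / 10000 * h ^ 6 <= damp N t z * chord z ^ 2, chord z <= 1551 / 10000 * t,
      917 / 1000 <= cos (defect N t z + z) & 0 <= sin (defect N t z + 3 / 2 * z) <= 408 / 1000].
Proof.
move=> t0 h0 th zh; have h3 : 0 < h ^ 3 by apply: pow_lt; lra.
have h3' : h ^ 3 <= (1292 / 10000) ^ 3 by apply: pow_incr; lra.
have pi3 : 3 < PI by have := PI2_3_2; lra.
have z0 : 0 <= z <= 6 / 5 * h ^ 3 by lra.
have [lo up] := phase_scaled N t h z (6 / 5) t0 (proj1 h0) th z0 (ltac:(lra)).
rewrite -/(defect N t z) in lo up.
have d := damp_ge_scaled N t h z t0 (proj1 h0) th (proj1 z0).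
pose y := z / h ^ 3; have zE : z = y * h ^ 3 by rewrite /y; field; lra.
have y01 : 1 / 2 <= y <= 6 / 5.
  by rewrite /y; split; [apply: (proj1 (Rle_div_r _ _ _ h3)) | apply/Rle_div_l]; lra.
split.
- have w := window_ge (y ^ 2) (ltac:(nra)).
  have dE : 5 / 3 * z ^ 2 / h ^ 6 = 5 / 3 * y ^ 2 by rewrite zE; field; lra.
  rewrite dE in d.
  have c := cosB_ge_quartic z (proj1 z0); rewrite chord_sqr.
  have c2 : z ^ 2 * (9999 / 10000) <= 2 * (1 - cos z).
    have : z ^ 2 <= 1 / 10000 by nra.
    by have := pow2_ge_0 z; nra.
  have e0 := exp_pos (- (5 / 3 * y ^ 2)).
  apply: Rle_trans (_ : exp (- (5 / 3 * y ^ 2)) * (z ^ 2 * (9999 / 10000)) <= _); last first.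
    by apply: Rmult_le_compat => //; [lra | have := pow2_ge_0 z; lra].
  have -> : exp (- (5 / 3 * y ^ 2)) * (z ^ 2 * (9999 / 10000)) =
    h ^ 6 * (y ^ 2 * exp (- (5 / 3 * y ^ 2)) * (9999 / 10000)) by rewrite zE; ring.
  by rewrite Rmult_comm; apply: Rmult_le_compat_l; [apply: pow_le; lra | lra].
- have [_ c] := chord_bounds z (ltac:(lra)); rewrite th; nra.
- have := cosB_le_sqr (defect N t z + z).
  have : 0 <= defect N t z + z <= 406 / 1000 by lra.
  by nra.
- split; first by apply: sin_ge_0; lra.
  by have := sin_le_id (defect N t z + 3 / 2 * z) (ltac:(lra)); lra.
Qed.

Lemma abs_pow_chord z k : 0 <= z <= PI -> 0 <= chord z ^ k <= z ^ k.
Proof.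
by move=> z0; have c := chord_bounds z z0; split; [apply: pow_le | apply: pow_incr]; lra.
Qed.

(** In the core [chord x] is at most 9/5 h t, smaller than q, which is about 2 t, by a factor of
    order h; hence the cosine term prevails. In the tail the integrand is at most
    [damp N t x * (2 t x^2 + x^3)], which is exactly [tailf]. The bound is 0.147 - 0.07. *)
Lemma RInt_gap_ge N t h (q := 1 - exp (- (2 * t))) :
    0 < t <= 1 / 60 -> tail_small N t -> 0 < h -> t = h ^ 2 ->
  77 / 1000 * h ^ 11 <= RInt (fun x => q * term2 N t x + -1 * term3 N t x) 0 PI.
Proof.
move=> t01 small h0 th; have h1 : h <= 1292 / 10000 by nra.
have h3 : 0 < h ^ 3 by apply: pow_lt.
have h3' : h ^ 3 <= (1292 / 10000) ^ 3 by apply: pow_incr; lra.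
have pi3 : 3 < PI by have := PI2_3_2; lra.
have qt := decay_factor t t01; rewrite -/q in qt.
set X0 := 9 / 5 * h ^ 3; have X00 : 0 < X0 by rewrite /X0; lra.
have V := RInt_tailf_le N t h t01 small h0 th; rewrite -/X0 in V.
have h11 : 0 < h ^ 11 by apply: pow_lt.
have h6 : 0 < h ^ 6 by apply: pow_lt.
have factor x : q * term2 N t x + -1 * term3 N t x =
    damp N t x * (chord x ^ 2 * (q * cos (defect N t x + x) - chord x * sin (defect N t x + 3 / 2 * x))).
  by rewrite /term2 /term3; ring.
have := RInt_ge_window (fun x => q * term2 N t x + -1 * term3 N t x) (tailf N t)
  (1 / 2 * h ^ 3) (6 / 5 * h ^ 3) X0 PI (21 / 100 * h ^ 8).
have e : 21 / 100 * h ^ 8 * (6 / 5 * h ^ 3 - 1 / 2 * h ^ 3) = 147 / 1000 * h ^ 11 by field.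
rewrite e => W; apply: Rle_trans (W _ _ _ _ _ _ _); first lra.
- by lra.
- by rewrite /X0; lra.
- move=> z; apply: (continuous_plus (fun z => q * term2 N t z) (fun z => -1 * term3 N t z)).
    apply: continuous_mult; [exact: continuous_const | by apply: continuous_term2; lra].
  by apply: continuous_mult; [exact: continuous_const | apply: continuous_term3; lra].
- by move=> z; apply: continuous_tailf; lra.
- move=> z zX; have [c0 _ s0 c2 _] := core_angles N t h z (ltac:(lra)) (ltac:(lra)) th zX.
  rewrite factor; apply: Rmult_le_pos; first by apply/Rlt_le/damp_gt0; lra.
  apply: Rmult_le_pos; first exact: pow2_ge_0.
  have : chord z <= 234 / 1000 * t by rewrite /X0 in zX; rewrite th; nra.
  move: (cos _) (sin _) s0 c2 => c s s0 c2 cz.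
  have : q * (19 / 100) <= q * c by apply: Rmult_le_compat_l; lra.
  have : chord z * s <= chord z * 1 by apply: Rmult_le_compat_l; lra.
  by lra.
- move=> z zh; have [w cz c s] := window_term N t h z (proj1 t01) (ltac:(lra)) th zh.
  rewrite factor -Rmult_assoc.
  have [c0 _] := chord_bounds z (ltac:(lra)).
  move: (cos _) (sin _) c s => c s c1 s1.
  have q1 : q * (917 / 1000) <= q * c by apply: Rmult_le_compat_l; lra.
  have q2 : chord z * s <= 1551 / 10000 * t * (408 / 1000) by apply: Rmult_le_compat; lra.
  have q3 : 173 / 100 * t <= q * c - chord z * s by lra.
  apply: Rle_trans (_ : 1249 / 10000 * h ^ 6 * (173 / 100 * t) <= _).
    have -> : 1249 / 10000 * h ^ 6 * (173 / 100 * t) = h ^ 8 * (1249 / 10000 * (173 / 100)).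
      by rewrite th; ring.
    by have : 0 < h ^ 8 by [apply: pow_lt]; lra.
  by apply: Rmult_le_compat; lra.
- move=> z zX; have dp := damp_gt0 N t z (proj1 t01).
  have [lo2 up2] := abs_term_le (damp N t z) _ _ _ (ltac:(lra)) (abs_pow_chord z 2 (ltac:(lra)))
    (COS_bound (defect N t z + z)).
  have [lo3 up3] := abs_term_le (damp N t z) _ _ _ (ltac:(lra)) (abs_pow_chord z 3 (ltac:(lra)))
    (SIN_bound (defect N t z + 3 / 2 * z)).
  rewrite -/(term2 N t z) in lo2 up2; rewrite -/(term3 N t z) in lo3 up3.
  have -> : tailf N t z = 2 * t * (damp N t z * z ^ 2) + damp N t z * z ^ 3.
    by rewrite /tailf; ring.
  have p2 : 0 <= damp N t z * z ^ 2 by apply: Rmult_le_pos; nra.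
  have : - (2 * t * (damp N t z * z ^ 2)) <= q * term2 N t z.
    apply: Rle_trans (_ : q * - (damp N t z * z ^ 2) <= _); first by nra.
    by apply: Rmult_le_compat_l; lra.
  by lra.
Qed.

(** The sign allows the lower bound on m1 to be multiplied by this sum. The upper bound may be
    wasteful, since the product is smaller than the main term by a factor h; [damp <= 1] is enough
    in the core. *)
Lemma RInt_sum_bounds N t h :
    0 < t <= 1 / 60 -> tail_small N t -> 0 < h -> t = h ^ 2 ->
  0 <= RInt (fun x => 1 * term2 N t x + 1 * term3 N t x) 0 PI <= 6 * h ^ 9.
Proof.
move=> t01 small h0 th; have h1 : h <= 1292 / 10000 by nra.
have h3 : 0 < h ^ 3 by apply: pow_lt.
have h3' : h ^ 3 <= (1292 / 10000) ^ 3 by apply: pow_incr; lra.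
have pi3 : 3 < PI by have := PI2_3_2; lra.
set X0 := 9 / 5 * h ^ 3; have X00 : 0 < X0 by rewrite /X0; lra.
have V := RInt_tailf_le N t h t01 small h0 th; rewrite -/X0 in V.
have h9 : 0 < h ^ 9 by apply: pow_lt.
have h6 : 0 < h ^ 6 by apply: pow_lt.
pose k := / (2 * t); have k0 : 0 < k by apply: Rinv_0_lt_compat; lra.
have ct x : continuous (tailf N t) x by apply: continuous_tailf; lra.
have ck x : continuous (fun z => k * tailf N t z) x.
  by apply: continuous_mult => //; exact: continuous_const.
have kV : k * RInt (tailf N t) X0 PI <= 35 / 1000 * h ^ 9.
  apply: Rle_trans (Rmult_le_compat_l _ _ _ (Rlt_le _ _ k0) V) _.
  by right; rewrite /k th; field; lra.
set f := fun x => 1 * term2 N t x + 1 * term3 N t x.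
have cf x : continuous f x.
  apply: (continuous_plus (fun z => 1 * term2 N t z) (fun z => 1 * term3 N t z)).
    apply: continuous_mult; [exact: continuous_const | by apply: continuous_term2; lra].
  by apply: continuous_mult; [exact: continuous_const | apply: continuous_term3; lra].
have bound z : 0 <= z <= PI ->
    - (damp N t z * (z ^ 2 + z ^ 3)) <= f z <= damp N t z * (z ^ 2 + z ^ 3).
  move=> zX; have dp := damp_gt0 N t z (proj1 t01).
  have := abs_term_le (damp N t z) _ _ _ (ltac:(lra)) (abs_pow_chord z 2 (ltac:(lra)))
    (COS_bound (defect N t z + z)).
  have := abs_term_le (damp N t z) _ _ _ (ltac:(lra)) (abs_pow_chord z 3 (ltac:(lra)))
    (SIN_bound (defect N t z + 3 / 2 * z)).
  rewrite -/(term2 N t z) -/(term3 N t z) /f Rmult_plus_distr_l; lra.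
have tail z : X0 <= z <= PI -> damp N t z * (z ^ 2 + z ^ 3) <= k * tailf N t z.
  move=> zX; have dp := damp_gt0 N t z (proj1 t01).
  rewrite /tailf -Rmult_assoc (Rmult_comm k) Rmult_assoc; apply: Rmult_le_compat_l; first lra.
  rewrite (Rmult_comm k); apply: (proj1 (Rle_div_r _ _ (2 * t) (ltac:(lra)))).
  have : 0 <= z ^ 2 by nra.
  have : 0 <= z ^ 3 by apply: pow_le; lra.
  by nra.
have nonneg z : 0 <= z <= X0 -> term2 N t z <= f z /\ 0 <= f z.
  move=> zX; have [c0 _ s0 c2 _] := core_angles N t h z (ltac:(lra)) (ltac:(lra)) th zX.
  have dp := damp_gt0 N t z (proj1 t01).
  have : 0 <= term2 N t z.
    by apply: Rmult_le_pos; [lra | apply: Rmult_le_pos; [exact: pow2_ge_0 | lra]].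
  have : 0 <= term3 N t z.
    by apply: Rmult_le_pos; [lra | apply: Rmult_le_pos; [apply: pow_le|]; lra].
  by rewrite /f; lra.
split.
  have := RInt_ge_window f (fun z => k * tailf N t z)
    (1 / 2 * h ^ 3) (6 / 5 * h ^ 3) X0 PI (11 / 100 * h ^ 6).
  have e : 11 / 100 * h ^ 6 * (6 / 5 * h ^ 3 - 1 / 2 * h ^ 3) = 77 / 1000 * h ^ 9 by field.
  rewrite e RInt_tail_scal // => W; apply: Rle_trans (W _ _ _ _ _ _ _) => //; first lra.
  - by lra.
  - by rewrite /X0; lra.
  - by move=> z /nonneg[].
  - move=> z zh; have [w cz c s] := window_term N t h z (proj1 t01) (ltac:(lra)) th zh.
    have [+ _] := nonneg z (ltac:(rewrite /X0; lra)); apply: Rle_trans.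
    rewrite /term2 -Rmult_assoc.
    apply: Rle_trans (_ : 1249 / 10000 * h ^ 6 * (917 / 1000) <= _); first lra.
    by apply: Rmult_le_compat; lra.
  - move=> z zX; have [+ _] := bound z (ltac:(lra)); apply: Rle_trans.
    by apply: Ropp_le_contravar; apply: tail.
rewrite (RInt_split f 0 X0) //.
have i1 : RInt f 0 X0 <= X0 ^ 2 * (1 + X0) * (X0 - 0).
  apply: RInt_le_const => //; first lra.
  move=> z zX; have [_ up] := bound z (ltac:(rewrite /X0 in zX *; lra)).
  apply: Rle_trans up _; have d1 := damp_le1 N t z (proj1 t01); have dp := damp_gt0 N t z (proj1 t01).
  have z2 : z ^ 2 <= X0 ^ 2 by apply: pow_incr; lra.
  have z3 : z ^ 3 <= X0 ^ 3 by apply: pow_incr; lra.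
  have z20 : 0 <= z ^ 2 by nra.
  have z30 : 0 <= z ^ 3 by apply: pow_le; lra.
  have : damp N t z * (z ^ 2 + z ^ 3) <= 1 * (z ^ 2 + z ^ 3) by apply: Rmult_le_compat_r; lra.
  by lra.
have i2 : RInt f X0 PI <= RInt (fun z => k * tailf N t z) X0 PI.
  apply: RInt_le; [by rewrite /X0; lra | exact: ex_RInt_cont | exact: ex_RInt_cont |].
  move=> z zX; have [_ up] := bound z (ltac:(lra)); apply: Rle_trans up _.
  by apply: tail; lra.
rewrite RInt_tail_scal // in i2.
have i3 : X0 ^ 2 * (1 + X0) * (X0 - 0) <= 59 / 10 * h ^ 9.
  have -> : X0 ^ 2 * (1 + X0) * (X0 - 0) = h ^ 9 * ((9 / 5) ^ 3 * (1 + X0)) by rewrite /X0; ring.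
  by rewrite Rmult_comm; apply: Rmult_le_compat_r; rewrite /X0; lra.
by lra.
Qed.

(* [P j] is proportional to e^(-jt) p(n-1+j). *)
Theorem turan_core N t (E := exp t) (P : R -> R := fun j => RInt (wave N t (mean N t + j)) 0 PI) :
    0 < t <= 1 / 60 -> tail_small N t ->
  (E * P 1) * (E * P 1 + E ^ 3 * P 3) <= (E ^ 2 * P 2) * (P 0 + E ^ 2 * P 2).
Proof.
(* Makes the width t^(3/2) an integral power. *)
move=> t01 small; pose h := sqrt t; have h0 : 0 < h by apply: sqrt_lt_R0; lra.
have th : t = h ^ 2 by rewrite /h pow2_sqrt; lra.
have h1 : h <= 1292 / 10000 by nra.
have cw j x : continuous (wave N t (mean N t + j)) x by apply: continuous_wave; lra.
have P0 : RInt (wave N t (mean N t)) 0 PI = P 0 by rewrite /P Rplus_0_r.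
have cw0 x : continuous (wave N t (mean N t)) x by apply: continuous_wave; lra.
have c1 x : continuous (term1 N t) x by apply: continuous_term1; lra.
have c2 x : continuous (term2 N t) x by apply: continuous_term2; lra.
have c3 x : continuous (term3 N t) x by apply: continuous_term3; lra.
have cl (f g : R -> R) a b : (forall x, continuous f x) -> (forall x, continuous g x) ->
    forall x, continuous (fun x => a * f x + b * g x) x.
  move=> cf cg x; apply: (continuous_plus (fun x => a * f x) (fun x => b * g x));
  by apply: continuous_mult => //; exact: continuous_const.
have ext (f g : R -> R) : (forall x, f x = g x) -> RInt f 0 PI = RInt g 0 PI :> R.
  by move=> fg; apply: RInt_ext => x _.
have m1E : (RInt (term1 N t) 0 PI : R) = P 0 - P 1.
  rewrite (ext _ (fun x => 1 * wave N t (mean N t) x + -1 * wave N t (mean N t + 1) x)).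
    by rewrite RInt_lin // P0 -/(P 1); ring.
  by move=> x; rewrite /term1 -wave_diff1; ring.
have m2E : (RInt (term2 N t) 0 PI : R) = 2 * P 1 - P 0 - P 2.
  rewrite (ext _ (fun x => 2 * wave N t (mean N t + 1) x +
     -1 * (1 * wave N t (mean N t) x + 1 * wave N t (mean N t + 2) x))).
    rewrite !RInt_lin //; try exact: cl.
    by rewrite P0 -/(P 1) -/(P 2); ring.
  by move=> x; rewrite /term2 -wave_diff2; ring.
have m3E : (RInt (term3 N t) 0 PI : R) = P 3 - 3 * P 2 + 3 * P 1 - P 0.
  rewrite (ext _ (fun x => 1 * (1 * wave N t (mean N t + 3) x + -3 * wave N t (mean N t + 2) x) +
     1 * (3 * wave N t (mean N t + 1) x + -1 * wave N t (mean N t) x))).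
    rewrite !RInt_lin //; try exact: cl.
    by rewrite P0 -/(P 1) -/(P 2) -/(P 3); ring.
  by move=> x; rewrite /term3 -wave_diff3; ring.
have b0 := RInt_wave0_ge N t h t01 small h0 th.
have b1 := RInt_term1_ge N t h t01 small h0 th.
have b2 := RInt_gap_ge N t h t01 small h0 th.
have b3 := RInt_sum_bounds N t h t01 small h0 th.
have EE : exp (- (2 * t)) = / E ^ 2.
  by rewrite exp_Ropp; congr (/ _); have -> : 2 * t = INR 2 * t by []; rewrite exp_nat_mul.
rewrite RInt_lin // EE in b2; rewrite RInt_lin // in b3; rewrite P0 in b0.
move: b1 b2 b3; set m1 := RInt (term1 N t) 0 PI; set m2 := RInt (term2 N t) 0 PI.
set m3 := RInt (term3 N t) 0 PI => b1 b2 b3.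
have E0 : 0 < E := exp_pos t.
have E1 : 0 <= 1 - / E ^ 2 by rewrite -EE; have := decay_factor t t01; lra.
suff main : 0 <= (1 - / E ^ 2) * m1 ^ 2 + P 0 * ((1 - / E ^ 2) * m2 + -1 * m3) + m1 * (m2 + m3) + m2 ^ 2.
  have e : (E ^ 2 * P 2) * (P 0 + E ^ 2 * P 2) - (E * P 1) * (E * P 1 + E ^ 3 * P 3) =
    E ^ 4 * ((1 - / E ^ 2) * m1 ^ 2 + P 0 * ((1 - / E ^ 2) * m2 + -1 * m3) + m1 * (m2 + m3) + m2 ^ 2).
    by rewrite /m1 /m2 /m3 m1E m2E m3E; field; lra.
  have := Rmult_le_pos (E ^ 4) _ (pow_le E 4 (Rlt_le _ _ E0)) main; lra.
have h3 : 0 < h ^ 3 by apply: pow_lt.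
have h6 : 0 < h ^ 6 by apply: pow_lt.
have h11 : 0 < h ^ 11 by apply: pow_lt.
have h9 : 0 < h ^ 9 by apply: pow_lt.
have h14 : 0 < h ^ 14 by apply: pow_lt.
have q1 : 285 / 1000 * h ^ 3 * (77 / 1000 * h ^ 11) <= P 0 * ((1 - / E ^ 2) * m2 + -1 * m3).
  by apply: Rmult_le_compat; lra.
have q2 : - (2 / 100 * h ^ 6 * (6 * h ^ 9)) <= m1 * (m2 + m3).
  have := Rmult_le_compat_r (m2 + m3) _ _ (ltac:(lra)) b1.
  have : 2 / 100 * h ^ 6 * (m2 + m3) <= 2 / 100 * h ^ 6 * (6 * h ^ 9).
    by apply: Rmult_le_compat_l; lra.
  by lra.
have q3 : 2 / 100 * h ^ 6 * (6 * h ^ 9) <= 285 / 1000 * h ^ 3 * (77 / 1000 * h ^ 11).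
  have -> : 2 / 100 * h ^ 6 * (6 * h ^ 9) = h ^ 14 * (12 / 100 * h) by field.
  have -> : 285 / 1000 * h ^ 3 * (77 / 1000 * h ^ 11) = h ^ 14 * (285 / 1000 * (77 / 1000)) by field.
  by apply: Rmult_le_compat_l; lra.
have q4 : 0 <= (1 - / E ^ 2) * m1 ^ 2 by apply: Rmult_le_pos => //; exact: pow2_ge_0.
by have := pow2_ge_0 m2; lra.
Qed.

(** * The saddle point *)

Lemma continuous_mean N t : 0 < t -> continuity_pt (mean N) t.
Proof.
move=> t0; apply/continuity_pt_filterlim; elim: N => [|N IHN]; first exact: continuous_const.
apply: (continuous_plus (mean N)) => //.
apply: ex_derive_continuous; have := rr_bound t N t0; rewrite /rr.
by move: (INR (S N)) => k r01; auto_derive; lra.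
Qed.

(** With y = k t the term is k / (e^y - 1), and e^y <= 1 + 2 y on [0, 1] because the chord of exp
    has slope e - 1 <= 2. *)
Lemma mean_term_ge t k : 0 < t -> INR (S k) * t <= 1 ->
  / (2 * t) <= INR (S k) * (rr t (S k) / (1 - rr t (S k))).
Proof.
move=> t0 kt; have r01 := rr_bound t k t0; have k0 : 0 < INR (S k) by apply: lt_0_INR; lia.
set y := INR (S k) * t in kt; have y0 : 0 < y by apply: Rmult_lt_0_compat.
have ey : exp y <= 1 + 2 * y.
  have := exp_le_chord 0 1 y (ltac:(lra)); have -> : (1 - y) * 0 + y * 1 = y by ring.
  by rewrite exp_0; have := exp_le_3; nra.
have rE : exp y * rr t (S k) = 1 by rewrite /rr -exp_plus Rplus_opp_r exp_0.
have e1 : / (2 * t) = INR (S k) / (2 * y) by rewrite /y; field; lra.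
rewrite e1; apply: Rmult_le_compat_l; first lra.
apply: (proj1 (Rle_div_r _ _ _ (ltac:(lra) : 0 < 1 - rr t (S k)))).
have -> : / (2 * y) * (1 - rr t (S k)) = (1 - rr t (S k)) / (2 * y) by field; lra.
by apply/Rle_div_l; nra.
Qed.

Lemma mean_ge t K N : 0 < t -> INR K * t <= 1 -> (K <= N)%coq_nat -> INR K / (2 * t) <= mean N t.
Proof.
move=> t0 Kt KN.
have grow n m : mean n t <= mean (m + n)%coq_nat t.
  elim: m => [|m IHm]; first by apply: Rle_refl.
  apply: Rle_trans IHm _; have r01 := rr_bound t (m + n)%coq_nat t0.
  have -> : mean (S m + n)%coq_nat t = mean (m + n)%coq_nat t +
    INR (S (m + n)%coq_nat) * (rr t (S (m + n)%coq_nat) / (1 - rr t (S (m + n)%coq_nat))) by [].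
  suff : 0 <= INR (S (m + n)%coq_nat) * (rr t (S (m + n)%coq_nat) / (1 - rr t (S (m + n)%coq_nat))) by lra.
  by apply: Rmult_le_pos; [apply: pos_INR | apply: Rdiv_le_0_compat; lra].
have -> : N = ((N - K) + K)%coq_nat by lia.
apply: Rle_trans (grow K _); clear KN; elim: K Kt => [|K IHK] Kt.
  by rewrite /mean /=; lra.
have Kt' : INR K * t <= 1 by move: Kt; rewrite S_INR; nra.
have := IHK Kt'; have := mean_term_ge t K t0 Kt.
have -> : mean (S K) t = mean K t + INR (S K) * (rr t (S K) / (1 - rr t (S K))) by [].
by rewrite (S_INR K) /Rdiv Rmult_plus_distr_r; lra.
Qed.

(* [mean_le] forces t <= 1/60 as soon as m > (5/3) 60^2 = 6000. *)
Lemma saddle_exists (m : nat) : (6001 <= Z.of_nat m)%Z -> exists N t,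
  [/\ (m + 3 <= N)%coq_nat, 0 < t <= 1 / 60, tail_small N t & mean N t = INR m].
Proof.
(* At t = 1/m the mean is at least m^2 / 2 > m, so the saddle has t >= 1/m; then N t >= 2 m and the
   tail is controlled by e^(-2m). *)
move=> m6; pose N := (2 * (m * m))%coq_nat; exists N.
have M6 : 6001 <= INR m by rewrite -[6001]/(IZR 6001) INR_IZR_INZ; apply: IZR_le; lia.
have NE : INR N = 2 * (INR m * INR m) by rewrite /N !mult_INR.
have m0 : 0 < / INR m by apply: Rinv_0_lt_compat; lra.
have m1 : / INR m < 1 / 60 by rewrite /Rdiv Rmult_1_l; apply: Rinv_lt_contravar; nra.
have lo : INR m < mean N (/ INR m).
  have mK : INR m * / INR m <= 1 by rewrite Rinv_r; lra.
  have := mean_ge (/ INR m) m N m0 mK (ltac:(nia)).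
  have -> : INR m / (2 * / INR m) = INR m * INR m / 2 by field; lra.
  by nra.
have up : mean N (1 / 60) < INR m by have := mean_le N (1 / 60) (ltac:(lra)); lra.
pose f t := INR m - mean N t.
have cf a : / INR m <= a <= 1 / 60 -> continuity_pt f a.
  move=> am; apply: continuity_pt_minus; first by apply: continuity_pt_const => ? ?.
  by apply: continuous_mean; lra.
have f0 : f (/ INR m) < 0 by rewrite /f; lra.
have f1 : 0 < f (1 / 60) by rewrite /f; lra.
have [t [t01 tE]] := IVT_interv f _ _ cf m1 f0 f1; rewrite /f in tE.
have t0 : 0 < t by lra.
exists t; split; [nia | lra | | lra].
rewrite /tail_small -exp_nat_mul.
have e1 := expN_lt1 t t0.
have Nt : 2 * INR m <= INR N * t.
  rewrite NE; have : 1 <= INR m * t.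
    by rewrite -(Rinv_r (INR m)); [apply: Rmult_le_compat_l; lra | lra].
  by nra.
have eN : exp (INR N * - t) <= / (1 + 2 * INR m + (2 * INR m) ^ 2 / 2).
  have -> : INR N * - t = - (INR N * t) by ring.
  rewrite exp_Ropp; apply: Rinv_le_contravar; first nra.
  apply: Rle_trans (exp_ge_quad (2 * INR m) (ltac:(lra))) _; exact: exp_le_compat.
have d1 : / (2 * INR m) <= 1 - exp (- t).
  have : exp (- t) <= / (1 + t).
    by rewrite exp_Ropp; apply: Rinv_le_contravar; [lra | exact: exp_ineq1_le].
  have : / (1 + t) <= 1 - t / 2.
    by apply: (Rmult_le_reg_l (1 + t)); [lra | rewrite Rinv_r; nra].
  have -> : / (2 * INR m) = / INR m / 2 by field; lra.
  by lra.
have d2 : 0 < / (2 * INR m) by apply: Rinv_0_lt_compat; lra.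
apply/Rle_div_l; first lra.
apply: Rle_trans (_ : 1 / 1000 * / (2 * INR m) <= _); last by apply: Rmult_le_compat_l; lra.
apply: Rle_trans (Rmult_le_compat_l 2 _ _ (ltac:(lra)) eN) _.
have -> : 1 / 1000 * / (2 * INR m) = / (2000 * INR m) by field; lra.
have -> : 2 * / (1 + 2 * INR m + (2 * INR m) ^ 2 / 2) =
  / ((1 + 2 * INR m + (2 * INR m) ^ 2 / 2) / 2) by field; nra.
by apply: Rinv_le_contravar; nra.
Qed.

Lemma pprod_gt0 f n : (forall k, 0 < f (S k)) -> 0 < pprod f n.
Proof. by move=> f0; elim: n => [|n IHn] /=; [lra | apply: Rmult_lt_0_compat]. Qed.

(** The three equations determine pz, so the analytic half needs no combinatorial definition. With N
    >= m + 3 the bound on the parts is no restriction for the four values. *)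
Theorem partition_turan_large (pz : nat -> Z -> R) (m : nat) :
    (forall m, pz O m = if (m =? 0)%Z then 1 else 0) ->
    (forall N m, pz (S N) m = pz N m + pz (S N) (m - Z.of_nat (S N))%Z) ->
    (forall N m, (m < 0)%Z -> pz N m = 0) ->
    (6001 <= Z.of_nat m)%Z ->
  exists N, (m + 3 <= N)%coq_nat /\
    let p j := pz N (Z.of_nat m + j)%Z in
    p 1%Z * (p 1%Z + p 3%Z) <= p 2%Z * (p 0%Z + p 2%Z).
Proof.
move=> pz0 pzS pz_neg m6; have [N [t [mN t01 small mE]]] := saddle_exists m m6.
exists N; split=> //= ; have core := turan_core N t t01 small.
set p := fun j => pz N (Z.of_nat m + j)%Z.
pose w := PI * pprod (fun k => 1 - rr t k) N * exp (- (INR m * t)).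
have w0 : 0 < w.
  apply: Rmult_lt_0_compat; last exact: exp_pos.
  apply: Rmult_lt_0_compat; first exact: PI_RGT_0.
  by apply: pprod_gt0 => k; have := rr_bound t k (proj1 t01); lra.
have PE (j : Z) : RInt (wave N t (mean N t + IZR j)) 0 PI = w * exp (- (IZR j * t)) * p j :> R.
  rewrite mE INR_IZR_INZ -plus_IZR (RInt_wave pz t (proj1 t01) pz0 pzS pz_neg).
  rewrite /w /p INR_IZR_INZ plus_IZR.
  have -> : exp (- ((IZR (Z.of_nat m) + IZR j) * t)) =
    exp (- (IZR (Z.of_nat m) * t)) * exp (- (IZR j * t)) by rewrite -exp_plus; congr exp; ring.
  by ring.
have Ej (j : nat) : exp t ^ j * exp (- (IZR (Z.of_nat j) * t)) = 1.
  by rewrite -exp_nat_mul -exp_plus INR_IZR_INZ Rplus_opp_r exp_0.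
rewrite !PE in core; rewrite Rmult_0_l Ropp_0 exp_0 in core.
have := Ej 1%nat; have := Ej 2%nat; have := Ej 3%nat => /= e3 e2 e1.
have g1 : exp t * (w * exp (- (1 * t)) * p 1%Z) = w * p 1%Z.
  by rewrite -(Rmult_1_l (w * p 1%Z)) -[X in _ = X * _]e1; ring.
have g2 : exp t ^ 2 * (w * exp (- (2 * t)) * p 2%Z) = w * p 2%Z.
  by rewrite -(Rmult_1_l (w * p 2%Z)) -[X in _ = X * _]e2; ring.
have g3 : exp t ^ 3 * (w * exp (- (3 * t)) * p 3%Z) = w * p 3%Z.
  by rewrite -(Rmult_1_l (w * p 3%Z)) -[X in _ = X * _]e3; ring.
rewrite g1 g2 g3 Rmult_1_r in core.
apply: (Rmult_le_reg_l (w * w)); first exact: Rmult_lt_0_compat.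
rewrite -/(p 1%Z) -/(p 2%Z) -/(p 3%Z) -/(p 0%Z); lra.
Qed.

(** * The partition function *)

Local Close Scope R_scope.
(* Importing again returns the scope delimiters %N and %Z to MathComp. *)
From mathcomp Require Import all_boot all_order all_algebra ring.
Set Implicit Arguments.
Unset Strict Implicit.
Import Order.TTheory GRing.Theory Num.Theory.

(* Partitions of [n] into parts at most [N], provided the fuel exceeds [N + n]. *)
Fixpoint plist (fuel N n : nat) : seq (seq nat) :=
  if fuel is f.+1 then
    if N is N'.+1 then
      plist f N' n ++ (if N <= n then map (cons N) (plist f N (n - N)) else [::])
    else if n == 0 then [:: [::]] else [::]
  else [::].

Lemma mem_plist f N n s : N + n < f ->
  (s \in plist f N n) = is_partition n s && all (fun i => i <= N) s.
Proof.
elim: f N n s => // f IHf [|N] n s ltf /=.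
  rewrite /is_partition; case: s => [|x s] /=; first by rewrite eq_sym; case: eqP.
  rewrite inE negb_or; have -> : (x <= 0) = (0 == x) by rewrite leqn0 eq_sym.
  by case: (n == 0); rewrite ?inE ?in_nil /=; case: (0 == x); rewrite ?andbF.
rewrite mem_cat IHf; last by lia.
have -> : (s \in (if N.+1 <= n then [seq N.+1 :: i | i <- plist f N.+1 (n - N.+1)] else [::])) =
    if s is x :: s' then [&& x == N.+1, N.+1 <= n & s' \in plist f N.+1 (n - N.+1)] else false.
  case: ifP => lt_Nn; last by case: s => //= x s; rewrite andbF.
  case: s => [|x s]; first by apply/negP => /mapP[].
  apply/mapP/idP => [[s' Ps' [-> ->]]|/and3P[/eqP-> _ Ps]]; first by rewrite eqxx.
  by exists s.
case: s => [|x s]; first by rewrite orbF.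
(* If n <= N, no part exceeds n and both bounds on the parts hold automatically. *)
case: (ltnP N n) => Nn; rewrite ?andbF; last first.
  rewrite orbF; apply: andb_id2l => /is_partition_bounds /andP[_ /allP lt_s].
  have alle M : n <= M -> all (fun i => i <= M) (x :: s).
    by move=> nM; apply/allP => i /lt_s; rewrite ltnS => /leq_trans; apply.
  by rewrite !alle // ltnW.
rewrite IHf; last by lia.
have geq_trans : transitive geq by move=> a b c ba cb; exact: leq_trans cb ba.
have headmax : is_partition n (x :: s) -> all (fun i => i <= x) s.
  by case/and3P => /=; rewrite (path_sortedE geq_trans) => /andP[].
case: (ltngtP x N.+1) => [lt_x|lt_x|->] /=.
- rewrite orbF; apply: andb_id2l => /headmax /allP le_s.
  rewrite -ltnS lt_x ltnW //=; apply/allP/allP => _ i /le_s le_i; lia.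
- by rewrite !(leqNgt x) lt_x (ltn_trans _ lt_x) // !andbF.
- rewrite ltnn andbF leqnn /is_partition /= (path_sortedE geq_trans) inE negb_or /=.
  have -> : (N.+1 + sumn s == n) = (sumn s == n - N.+1) by apply/eqP/eqP; lia.
  by case: (all _ s); rewrite /= ?andbF // !andbT.
Qed.

Lemma plist_uniq f N n : N + n < f -> uniq (plist f N n).
Proof.
elim: f N n => // f IHf [|N] n ltf /=; first by case: (n == 0).
rewrite cat_uniq IHf /=; last by lia.
case: ifP => // lt_Nn; rewrite map_inj_uniq; last by move=> s s' [].
rewrite IHf ?andbT; last by lia.
apply/hasPn => _ /mapP[s _ ->]; rewrite mem_plist; last by lia.
by rewrite /= ltnn andbF.
Qed.

Definition pcount (N n : nat) : nat := size (plist (N + n).+1 N n).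

Lemma pcountE f N n : N + n < f -> size (plist f N n) = pcount N n.
Proof.
move=> ltf; apply/perm_size/uniq_perm; try exact: plist_uniq.
by move=> s; rewrite !mem_plist.
Qed.

Lemma pcount0 n : pcount 0 n = (n == 0).
Proof. by rewrite /pcount; case: n. Qed.

Lemma pcountS N n :
  pcount N.+1 n = pcount N n + (if N < n then pcount N.+1 (n - N.+1) else 0).
Proof.
suff step f : (N.+1 + n < f.+1)%N -> pcount N.+1 n =
    pcount N n + (if N < n then pcount N.+1 (n - N.+1) else 0) by exact: step (ltnSn _).
move=> ltf; rewrite -(pcountE ltf) /= size_cat pcountE; last by lia.
by congr addn; case: ifP => // lt_Nn; rewrite size_map pcountE //; lia.
Qed.

Lemma nb_partitionsE N n : n <= N -> nb_partitions n = pcount N n.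
Proof.
move=> /subnK <-; elim: (N - n) => [|k IHk].
  apply: card_partitions => [|s]; first exact: plist_uniq.
  rewrite mem_plist //; apply: andb_idr => /is_partition_bounds /andP[_].
  by apply: sub_all => i; rewrite ltnS.
by rewrite addSn pcountS -IHk ltnNge leq_addl addn0.
Qed.

(** * Euler's pentagonal number theorem *)

Local Open Scope ring_scope.

(** Cut off at degree M, so that a power series identity becomes one between low coefficients of
    polynomials. *)
Definition pgen (M N : nat) : {poly int} := \poly_(n < M) (pcount N n)%:Z.

(** The quotient (q)_n / (q)_s of q-factorials, with q the variable. *)
Definition qpoch (s n : nat) : {poly int} := \prod_(s <= i < n) (1 - 'X^(i.+1)).

Lemma qpochS s n : (s <= n)%N -> qpoch s n.+1 = qpoch s n * (1 - 'X^(n.+1)).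
Proof. by move=> sn; rewrite /qpoch big_nat_recr. Qed.

Lemma qpochSl s n : (s < n)%N -> qpoch s n = (1 - 'X^(s.+1)) * qpoch s.+1 n.
Proof. by move=> sn; rewrite /qpoch big_ltn. Qed.

Lemma qpochnn n : qpoch n n = 1.
Proof. by rewrite /qpoch big_geq. Qed.

Lemma coefM_low (R : comNzRingType) (p q r : {poly R}) (M : nat) :
    (forall i, (i < M)%N -> p`_i = q`_i) ->
  forall i, (i < M)%N -> (r * p)`_i = (r * q)`_i.
Proof.
move=> pq i iM; rewrite !coefM; apply: eq_bigr => j _; rewrite pq //.
by apply: leq_ltn_trans iM; rewrite leq_subr.
Qed.

Lemma qpoch_pgen M N i : (i < M)%N -> (qpoch 0 N * pgen M N)`_i = (i == 0%N)%:R.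
Proof.
elim: N i => [|N IHN] i iM; first by rewrite qpochnn mul1r coef_poly iM pcount0; case: i {iM}.
rewrite qpochS // -mulrA -IHN //; apply: (@coefM_low _ _ _ _ M) => // j jM.
rewrite mulrBl mul1r coefB coefXnM !coef_poly jM pcountS.
case: (ltnP j N.+1) => jN; first by rewrite addn0 subr0.
by rewrite (leq_ltn_trans (leq_subr _ _) jM) PoszD addrK.
Qed.

(* Shanks's finite form of Euler's pentagonal number theorem; the terms with s > 0 have no
   monomial of degree at most n. *)
Definition shanks (n : nat) : {poly int} :=
  \sum_(s < n.+1) (-1) ^+ s * qpoch s n * 'X^(s * n + 'C(s.+1, 2)).

(** The exponents are the generalized pentagonal numbers k(3k-1)/2 and k(3k+1)/2, written without
    division. *)
Definition pent (K : nat) : {poly int} :=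
  1 + \sum_(1 <= k < K.+1) (-1) ^+ k * ('X^(k * k + 'C(k, 2)) + 'X^(k * k + 'C(k.+1, 2))).

(** From n to n+1, term s becomes [c s * 'X^s - b s]. Writing the first part as
    [c s - c s * (1 - 'X^s)] makes the sum telescope, since [c s.+1 * (1 - 'X^(s.+1)) = - b s]; what
    survives is b n and the new last term, the two new pentagonal powers. *)
Lemma shanksE n : shanks n = pent n.
Proof.
elim: n => [|n IHn].
  by rewrite /shanks /pent big_ord1 big_geq // qpochnn expr0 mul1r mul0n add0n bin_small // expr0 addr0 mulr1.
have -> : pent n.+1 = pent n + (-1) ^+ n.+1 *
    ('X^(n.+1 * n.+1 + 'C(n.+1, 2)) + 'X^(n.+1 * n.+1 + 'C(n.+2, 2))).
  by rewrite /pent big_nat_recr //= addrA.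
rewrite -IHn /shanks big_ord_recr /= qpochnn mulr1.
pose c s : {poly int} := (-1) ^+ s * qpoch s n * 'X^(s * n + 'C(s.+1, 2)).
pose b s : {poly int} := (-1) ^+ s * qpoch s n * 'X^(s * n + s + n.+1 + 'C(s.+1, 2)).
have -> : \sum_(s < n.+1) (-1) ^+ s * qpoch s n.+1 * 'X^(s * n.+1 + 'C(s.+1, 2)) =
    \sum_(s < n.+1) (c s - c s * (1 - 'X^s)) - \sum_(s < n.+1) b s.
  rewrite -sumrB; apply: eq_bigr => s _; rewrite qpochS ?leq_ord // /c /b.
  have -> : (s * n.+1 + 'C(s.+1, 2) = s * n + 'C(s.+1, 2) + s)%N by lia.
  have -> : (s * n + s + n.+1 + 'C(s.+1, 2) = s * n + 'C(s.+1, 2) + s + n.+1)%N by lia.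
  by rewrite !exprD; ring.
have shift s : (s < n)%N -> c s.+1 * (1 - 'X^(s.+1)) = - b s.
  move=> sn; rewrite /c /b (qpochSl sn) binS bin1.
  have -> : (s.+1 * n + ('C(s.+1, 2) + s.+1) = s * n + s + n.+1 + 'C(s.+1, 2))%N by lia.
  by rewrite exprS; ring.
have -> : \sum_(s < n.+1) (c s - c s * (1 - 'X^s)) = \sum_(s < n.+1) c s + \sum_(s < n) b s.
  rewrite sumrB; congr (_ + _); rewrite big_ord_recl expr0 subrr mulr0 add0r -sumrN.
  by apply: eq_bigr => s _; rewrite /= shift // opprK.
have bn : b n = - ((-1) ^+ n.+1 * 'X^(n.+1 * n.+1 + 'C(n.+1, 2))).
  by rewrite /b qpochnn mulr1 exprS mulN1r mulNr opprK; congr (_ * 'X^ _); lia.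
rewrite [\sum_(s < n.+1) b s]big_ord_recr /= bn -/(c _).
by move: (\sum_(s < n) b s) (\sum_(s < n.+1) _) => u v; ring.
Qed.

(** The test keeps truncated subtraction from reading p(0) = 1 when a > m. *)
Definition delayed (m a : nat) : int := if (m < a)%N then 0 else (nb_partitions (m - a))%:Z.

Lemma coef_pent_pgen M n m : (m < M)%N -> (m <= n)%N ->
  (pent n * pgen M n)`_m = (nb_partitions m)%:Z +
    \sum_(1 <= k < n.+1) (-1) ^+ k * (delayed m (k * k + 'C(k, 2)) + delayed m (k * k + 'C(k.+1, 2))).
Proof.
move=> mM mn; have dE a : ('X^a * pgen M n)`_m = delayed m a.
  rewrite coefXnM coef_poly /delayed (leq_ltn_trans (leq_subr _ _) mM).
  by case: ifP => // _; rewrite (nb_partitionsE (N := n)) //; lia.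
rewrite /pent mulrDl mul1r coefD coef_poly mM -(nb_partitionsE mn); congr (_ + _).
rewrite mulr_suml coef_sum; apply: eq_bigr => k _.
rewrite -[in LHS]signr_odd -[in RHS]signr_odd -mulrA !mulr_sign mulrDl.
by case: (odd k); rewrite ?coefN coefD !dE.
Qed.

(** Both exponents of index k are at least k^2, so indices k >= K contribute nothing when m <
    K^2. *)
Theorem pentagonal_recurrence m K : (0 < m)%N -> (m < K * K)%N ->
  (nb_partitions m)%:Z + \sum_(1 <= k < K)
    (-1) ^+ k * (delayed m (k * k + 'C(k, 2)) + delayed m (k * k + 'C(k.+1, 2))) = 0.
Proof.
move=> m0 mK; pose n := (m + K)%N.
have K0 : (0 < K)%N by case: K mK {n}.
have mn : (m <= n)%N by rewrite leq_addr.
have : (pent n * pgen m.+1 n)`_m = 0.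
  have e : qpoch 0 n = pent n - \sum_(s < n) (-1) ^+ s.+1 * qpoch s.+1 n * 'X^(s.+1 * n + 'C(s.+2, 2)).
    by rewrite -shanksE /shanks big_ord_recl expr0 mul1r mul0n bin_small // expr0 mulr1 addrK.
  have := qpoch_pgen n (ltnSn m); rewrite e mulrBl coefB eqn0Ngt m0 /=.
  rewrite mulr_suml coef_sum big1 ?subr0 // => s _.
  rewrite -mulrA mulrC -!mulrA coefXnM ifT //.
  by rewrite binS bin1; nia.
rewrite coef_pent_pgen // (@big_cat_nat _ _ _ K) //=; last by lia.
rewrite [X in _ + (_ + X)]big1_seq ?addr0 // => k; rewrite mem_index_iota => /andP[_ /andP[Kk _]].
have mk : (m < k * k)%N by apply: leq_trans mK _; rewrite leq_mul.
by rewrite /delayed !ifT ?addr0 ?mulr0 //; lia.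
Qed.

(** * Verification for small n *)

Local Notation bin_nat := BinNums.N.
Local Notation bin0 := BinNums.N0.

(* The table lists [p (m - 1), ..., p 0]; the offsets of the pentagonal
   recurrence are reached by skipping [j] and [d = 2 j + 2] entries alternately. *)
Fixpoint alternate (f j d : nat) (l : seq bin_nat) (s : bool) (a b : bin_nat) : bin_nat * bin_nat :=
  if f is f'.+1 then
    if l is x :: l1 then
      if drop j l1 is y :: l2 then
        if s then alternate f' j.+1 d.+2 (drop d l2) false (N.add a (N.add x y)) b
        else alternate f' j.+1 d.+2 (drop d l2) true a (N.add b (N.add x y))
      else if s then (N.add a x, b) else (a, N.add b x)
    else (a, b)
  else (a, b).

Local Open Scope ring_scope.

Definition entry (l : seq bin_nat) (i : nat) : int := (N.to_nat (nth bin0 l i))%:Z.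

Fixpoint alternating_sum (f j d : nat) (l : seq bin_nat) : int :=
  if f is f'.+1 then
    entry l 0 + entry l j.+1 - alternating_sum f' j.+1 d.+2 (drop (j + d).+2 l)
  else 0.

Lemma alternating_sum_nil f j d : alternating_sum f j d [::] = 0.
Proof. by elim: f j d => //= f IHf j d; rewrite IHf /entry !nth_nil. Qed.

(** The accumulators a and b hold the positive and the negative terms, as binary naturals have no
    sign; s tells which one is next. Reading 0 past the end of the list accounts for the early
    exits. *)
Lemma alternateE f j d l s a b (r := alternate f j d l s a b) :
  (N.to_nat r.1)%:Z - (N.to_nat r.2)%:Z =
  (N.to_nat a)%:Z - (N.to_nat b)%:Z + (-1) ^+ (~~ s) * alternating_sum f j d l.
Proof.
rewrite {}/r; elim: f j d l s a b => [|f IHf] j d l s a b; first by rewrite /= mulr0 addr0.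
case: l => [|x l]; first by rewrite alternating_sum_nil mulr0 addr0.
have dropE : drop (j + d).+1 l = drop d (behead (drop j l)).
  by rewrite -drop1 !drop_drop; congr drop; lia.
have entryE : entry (x :: l) j.+1 = entry (drop j l) 0 by rewrite /entry /= nth_drop addn0.
rewrite /= dropE entryE; case: (drop j l) => [|y l2]; last first.
  by case: s; rewrite IHf /entry /= ?expr0 ?expr1; lia.
by rewrite alternating_sum_nil; case: s; rewrite /entry /= ?expr0 ?expr1; lia.
Qed.

Definition table (m : nat) : seq bin_nat := [seq N.of_nat (nb_partitions i) | i <- rev (iota 0 m)].

Lemma tableS m : table m.+1 = N.of_nat (nb_partitions m) :: table m.
Proof. by rewrite /table -addn1 iotaD rev_cat. Qed.

Lemma entry_table m i : entry (table m) i = delayed m i.+1.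
Proof.
rewrite /entry /delayed /table ltnS; case: (leqP m i) => [mi|im].
  by rewrite nth_default // size_map size_rev size_iota.
rewrite (nth_map 0%N) ?size_rev ?size_iota // Nnat.Nat2N.id nth_rev ?size_iota //.
by rewrite nth_iota //; lia.
Qed.

(** Index c of the table holds p(m-1-c), hence c + 1 is the pentagonal offset. With k = j + 1, the
    two offsets of index k differ by k and the next one follows after 2k + 1 more. *)
Lemma alternating_sum_table f j c m : c.+1 = (j.+1 * j.+1 + 'C(j.+1, 2))%N ->
  alternating_sum f j (j.+1).*2 (drop c (table m)) =
  (-1) ^+ j.+1 * \sum_(j.+1 <= k < j.+1 + f) (-1) ^+ k *
       (delayed m (k * k + 'C(k, 2)) + delayed m (k * k + 'C(k.+1, 2))).
Proof.
elim: f j c => [|f IHf] j c cE; first by rewrite addn0 big_geq //= mulr0.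
have entry_drop i : entry (drop c (table m)) i = delayed m (c + i).+1.
  by rewrite -entry_table /entry nth_drop.
rewrite /= !entry_drop drop_drop (IHf j.+1); last by rewrite binS bin1; lia.
rewrite big_ltn; last by lia.
rewrite addSnnS addn0 cE mulrDr mulrA -expr2 sqrr_sign mul1r exprS mulN1r mulNr.
by rewrite opprK; congr (_ + delayed _ _ + _); rewrite binS bin1; lia.
Qed.

Definition next (f : nat) (l : seq bin_nat) : bin_nat :=
  (* Truncated subtraction is harmless on a table, where the difference is a partition number. *)
  let: (a, b) := alternate f 0 2 l true bin0 bin0 in N.sub a b.

Lemma next_table f m : (0 < m < f.+1 * f.+1)%N ->
  next f (table m) = N.of_nat (nb_partitions m).
Proof.
move=> /andP[m0 mf]; have := pentagonal_recurrence m0 mf.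
have := @alternating_sum_table f 0 0 m erefl; rewrite drop0 => e.
have := alternateE f 0 2 (table m) true bin0 bin0.
rewrite [alternating_sum _ _ _ _]e /next; case: (alternate _ _ _ _ _ _ _) => a b /=.
rewrite add1n expr1 expr0 mul1r mulN1r => e1 /eqP; rewrite addr_eq0 => /eqP e2.
rewrite -e2 in e1; lia.
Qed.

(* Truncating to about 32 leading bits, rounded the safe way, avoids the large products. *)
Definition turan_test (a b c d : bin_nat) : bool :=
  let s := N.sub (N.size a) 32 in
  if N.eqb s 0 then N.leb (N.mul b (N.add b d)) (N.mul c (N.add a c)) else
  let b' := N.shiftr b s in let c' := N.shiftr c s in
  N.leb (N.mul (N.add b' 1) (N.add (N.add b' (N.shiftr d s)) 2)) (N.mul c' (N.add (N.shiftr a s) c')).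

Lemma turan_testP a b c d :
  turan_test a b c d -> N.le (N.mul b (N.add b d)) (N.mul c (N.add a c)).
Proof.
rewrite /turan_test; move: (N.sub _ _) => s; case: ifP => _; first by move/N.leb_le.
rewrite !N.shiftr_div_pow2.
have p0 : N.lt 0 (N.pow 2 s) by apply/N.neq_0_lt_0/N.pow_nonzero.
move: (N.pow 2 s) p0 => p p0 /N.leb_le.
have bounds x : N.le (N.mul p (N.div x p)) x /\ N.lt x (N.mul p (N.add (N.div x p) 1)).
  by split; [apply: N.Div0.mul_div_le | rewrite N.add_1_r; apply: N.mul_succ_div_gt; lia].
move: (bounds a) (bounds b) (bounds c) (bounds d).
move: (N.div a p) (N.div b p) (N.div c p) (N.div d p) => a' b' c' d' [a1 _] [_ b2] [c1 _] [_ d2] test.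
apply: (N.le_trans _ (N.mul (N.mul p p) (N.mul (N.add b' 1) (N.add (N.add b' d') 2)))).
  apply: (N.le_trans _ (N.mul (N.mul p (N.add b' 1)) (N.mul p (N.add (N.add b' d') 2)))); last by lia.
  by apply: N.mul_le_mono; lia.
apply: (N.le_trans _ (N.mul (N.mul p p) (N.mul c' (N.add a' c')))).
  by apply: N.mul_le_mono_l.
apply: (N.le_trans _ (N.mul (N.mul p c') (N.mul p (N.add a' c')))); first by lia.
by apply: N.mul_le_mono; lia.
Qed.

Fixpoint grow (f n : nat) (l : seq bin_nat) : seq bin_nat :=
  if n is n'.+1 then grow f n' (next f l :: l) else l.

Fixpoint scan (f n : nat) (l : seq bin_nat) : bool :=
  if n is n'.+1 then
    let l' := next f l :: l in
    if l' is [:: d, c, b, a & _] then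
      if turan_test a b c d then scan f n' l' else false
    else false
  else true.

Lemma grow_table f n m : (0 < m)%N -> (m + n <= f.+1 * f.+1)%N -> grow f n (table m) = table (m + n).
Proof.
elim: n m => [|n IHn] m m0 mn; first by rewrite addn0.
by rewrite /= next_table ?m0 -?tableS ?IHn ?addSnnS //; lia.
Qed.

(** A step extends the table by p(m), so the four leading entries are p(m), ..., p(m-3) and the
    first index tested is m - 3. *)
Lemma scan_table f n m : (2 < m)%N -> (m + n <= f.+1 * f.+1)%N -> scan f n (table m) ->
  forall i, (m - 3 <= i < m - 3 + n)%N ->
  (nb_partitions i.+1 * (nb_partitions i.+1 + nb_partitions i.+3) <=
   nb_partitions i.+2 * (nb_partitions i + nb_partitions i.+2))%N.
Proof.
elim: n m => [|n IHn] [|[|[|m]]] // _ mn; first by move=> _ i; lia.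
have -> : scan f n.+1 (table m.+3) = (if next f (table m.+3) :: table m.+3 is [:: d, c, b, a & _]
    then if turan_test a b c d then scan f n (next f (table m.+3) :: table m.+3) else false
    else false) by [].
rewrite next_table; last by lia.
rewrite -tableS {1}tableS {1}tableS {1}tableS {1}tableS.
case: ifP => // /turan_testP test scanned i mi.
have [im|im] := eqVneq i m; first by rewrite im; lia.
by rewrite -tableS in scanned; apply: (IHn m.+4) => //; lia.
Qed.

(* Fuel 80 suffices for tables of length below 81^2 = 6561. *)
Lemma small_range_scanned : scan 80 (59 * 101) (grow 80 56 (table 1)) = true.
Proof.
have -> : table 1 = [:: BinNums.Npos BinNums.xH].
  by rewrite tableS (nb_partitionsE (leqnn 0)).
by vm_cast_no_check (erefl true).
Qed.

(** Growing to [table 57] makes 54 the first index tested; the 5959 steps reach index 6012, past the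
    6000 where the analytic bound takes over. *)
Lemma turan_small n : (54 <= n <= 60 * 100)%N ->
  (nb_partitions n.+1 * (nb_partitions n.+1 + nb_partitions n.+3) <=
   nb_partitions n.+2 * (nb_partitions n + nb_partitions n.+2))%N.
Proof.
move=> n54; have := small_range_scanned; rewrite grow_table //.
by move/scan_table; apply => //; lia.
Qed.

Lemma turan_large n : (60 * 100 < n)%N ->
  (nb_partitions n.+1 * (nb_partitions n.+1 + nb_partitions n.+3) <=
   nb_partitions n.+2 * (nb_partitions n + nb_partitions n.+2))%N.
Proof.
move=> n6.
pose pz N (m : BinNums.Z) := if Z.ltb m BinNums.Z0 then IZR BinNums.Z0 else INR (pcount N (Z.to_nat m)).
have pz_nat N k : pz N (Z.of_nat k) = INR (pcount N k).
  by rewrite /pz Nat2Z.id ifF //; apply/Z.ltb_ge; lia.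
have pz_neg N m : Z.lt m BinNums.Z0 -> pz N m = IZR BinNums.Z0.
  by move=> m0; rewrite /pz ifT //; apply/Z.ltb_lt.
have pz0 m : pz 0%N m = if Z.eqb m BinNums.Z0 then IZR (BinNums.Zpos BinNums.xH) else IZR BinNums.Z0.
  case: (Z.ltb_spec m BinNums.Z0) => [m0|/Z2Nat.id <-].
    by rewrite pz_neg // ifF //; apply/Z.eqb_neq; lia.
  by rewrite pz_nat pcount0; case: (Z.to_nat m).
have pzS N m : pz N.+1 m = Rplus (pz N m) (pz N.+1 (Z.sub m (Z.of_nat N.+1))).
  case: (Z.ltb_spec m BinNums.Z0) => [m0|/Z2Nat.id <-].
    by rewrite !pz_neg ?Rplus_0_l //; lia.
  move: (Z.to_nat m) => k; case: (ltnP N k) => kN; last first.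
    rewrite [X in Rplus _ X]pz_neg; last by lia.
    by rewrite Rplus_0_r !pz_nat pcountS ltnNge kN addn0.
  have -> : Z.sub (Z.of_nat k) (Z.of_nat N.+1) = Z.of_nat (k - N.+1) by lia.
  by rewrite !pz_nat pcountS kN -plus_INR.
have [|N [nN]] := @partition_turan_large pz n pz0 pzS pz_neg; first by lia.
have pE j : (j <= 3)%N -> pz N (Z.add (Z.of_nat n) (Z.of_nat j)) = INR (nb_partitions (n + j)).
  move=> j3; rewrite (nb_partitionsE (N := N)); last by lia.
  by rewrite -pz_nat Nat2Z.inj_add.
have := pE 0%N; have := pE 1%N; have := pE 2; have := pE 3.
rewrite addn0 addn1 addn2 addn3 => /(_ isT) /= -> /(_ isT) /= -> /(_ isT) /= -> /(_ isT) /= ->.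
rewrite -!plus_INR -!mult_INR => /INR_le; lia.
Qed.

Unset Implicit Arguments.

Theorem corollary2p6 (n : nat) (hn : (55 <= n)%N) :
  (nb_partitions n)%:Z ^+ 2
    - (nb_partitions n.-1)%:Z * (nb_partitions n.+1)%:Z
  <= (nb_partitions n.+1)%:Z ^+ 2
    - (nb_partitions n)%:Z * (nb_partitions n.+2)%:Z.
Proof.
case: n hn => // n hn; rewrite [n.+1.-1]/=.
(* After the shift of n by one, moving the mixed products across leaves an inequality of natural
   numbers without subtraction. *)
have turan : (nb_partitions n.+1 * (nb_partitions n.+1 + nb_partitions n.+3) <=
    nb_partitions n.+2 * (nb_partitions n + nb_partitions n.+2))%N.
  by case: (leqP n (60 * 100)) => n6; [apply: turan_small | apply: turan_large]; lia.
by rewrite !expr2; lia.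
Qed.
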